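(* Let $K$ be an $F$-finite field of prime characteristic $p$, let $G$ be a closed simple graph on $[n]=\{1,\ldots,n\}$, let $S=K[x_1,\ldots,x_n,y_1,\ldots,y_n]$, and let $\mathcal{J}_G\subseteq S$ be the binomial edge ideal of $G$. Let $\operatorname{In}(\mathcal{J}_G)$ be the initial ideal of $\mathcal{J}_G$ with respect to the lexicographic order induced by $x_1>x_2>\cdots>x_n>y_1>y_2>\cdots>y_n$. Then $$\operatorname{fpt}(S/\mathcal{J}_G)=\operatorname{fpt}(S/\operatorname{In}(\mathcal{J}_G)).$$
   Context: A field $K$ of characteristic $p>0$ is $F$-finite if $[K:K^p]<\infty$. Graphs: a simple graph has no loops or multiple edges. For a simple graph $G$ on $[n]$ with edge set $E(G)$, the binomial edge ideal is $\mathcal{J}_G=(f_{ij} : \{i,j\}\in E(G),\ i<j)\subseteq S$, where $f_{ij}=x_iy_j-x_jy_i$. The graph $G$ is closed with respect to the given labelling of its vertices if for all distinct edges $\{i,j\}$ and $\{k,l\}$ with $i<j$ and $k<l$, one has $\{j,l\}\in E(G)$ if $i=k$, and $\{i,k\}\in E(G)$ if $j=l$. $G$ is closed if there exists a labelling of its vertices such that $G$ is closed with respect to that labelling. $F$-pure threshold: a ring $R$ of characteristic $p$ is $F$-pure if the Frobenius map $F:R\to R$, $r\mapsto r^p$, is a pure homomorphism of $R$-modules; it is $F$-finite if $F$ makes $R$ a finitely generated $R$-module. For reduced $R$, $R^{1/p^e}$ denotes the ring of $p^e$-th roots of elements of $R$. Let $(R,\mathfrak{m},K)$ be a standard graded $K$-algebra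 with maximal homogeneous ideal $\mathfrak{m}$ which is $F$-finite and $F$-pure. For a homogeneous ideal $I\subseteq R$ and a real number $\lambda\geq 0$, the pair $(R,I^\lambda)$ is $F$-pure if for every $e\gg 0$ there is $f\in I^{\lfloor (p^e-1)\lambda\rfloor}$ such that the inclusion of $R$-modules $f^{1/p^e}R\subseteq R^{1/p^e}$ splits. Then $\operatorname{fpt}(I)=\sup\{\lambda\in\mathbb{R}_{\geq 0} : (R,I^\lambda)\text{ is }F\text{-pure}\}$ and $\operatorname{fpt}(R)=\operatorname{fpt}(\mathfrak{m})$.
   Formalization: G is assumed closed for the given labelling 1,…,n, not just for some labelling: for edges {1,2},{1,3} the thresholds are 2 and 1. ''f^{1/p^e}R splits'' is read as: the R-linear map R→R^{1/p^e}, 1↦f^{1/p^e}, splits, since otherwise f=0 would always qualify. *)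

(* Defs.v *)
From HB Require Import structures.
From mathcomp Require Import all_boot all_order all_algebra.
From mathcomp Require Import generic_quotient ring_quotient.
(* [mpoly] has to be imported before the analysis libraries: in the other order
   their notation levels clash. *)
From mathcomp Require Import mpoly.
From mathcomp Require Import boolp classical_sets reals constructive_ereal ereal.

Set Implicit Arguments.
Unset Strict Implicit.
Unset Printing Implicit Defensive.

Import Order.TTheory GRing.Theory Num.Theory.

Local Open Scope classical_set_scope.
Local Open Scope ring_scope.

Section Ideals.
Variable R : comNzRingType.

Definition ideal_gen (A : set R) : set R :=
  [set f | exists (k : nat) (a g : 'I_k -> R),
     (forall i, A (g i)) /\ f = \sum_(i < k) a i * g i].

(* The empty product gives [ideal_exp I 0 = setT]. *)
Definition ideal_exp (I : set R) (k : nat) : set R :=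
  ideal_gen [set f | exists g : 'I_k -> R,
     (forall i, I (g i)) /\ f = \prod_(i < k) g i].

Definition ideal_pred (A : set R) : {pred R} := fun f => `[< ideal_gen A f >].

Lemma ideal_gen_idealr (A : set R) :
  ~ ideal_gen A 1 -> idealr_closed (ideal_pred A).
Proof.
move=> A1; split.
- by apply/asboolP; exists 0%N, (fun=> 0), (fun=> 0); split=> [[]|]; rewrite ?big_ord0.
- by apply/asboolPn.
- move=> c u v /asboolP[k [a [g [Ag ->]]]] /asboolP[l [b [h [Ah ->]]]].
  apply/asboolP; exists (k + l)%N,
    (fun i => match split i with inl i => c * a i | inr i => b i end),
    (fun i => match split i with inl i => g i | inr i => h i end); split.
    by move=> i; case: (split i).
  rewrite big_split_ord /= mulr_sumr; congr (_ + _); apply: eq_bigr => i _.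
    by rewrite (unsplitK (inl i)) mulrA.
  by rewrite (unsplitK (inr i)).
Qed.

(* [ring_quotient] only forms quotients by proper ideals, hence the proof
   argument. *)
Definition generated_ideal (A : set R) (A1 : ~ ideal_gen A 1) : idealr R :=
  HB.pack (ideal_pred A)
    (isIdealr.Build R (ideal_pred A) (ideal_gen_idealr A1)).

End Ideals.

(* [R] is a finite module over its subring of [p]-th powers; for a field [K] this
   is [K : K^p] < oo. *)
Definition F_finite (p : nat) (R : comNzRingType) : Prop :=
  exists (k : nat) (b : 'I_k -> R),
    forall a : R, exists c : 'I_k -> R, a = \sum_(i < k) c i ^+ p * b i.

Section FpurePairs.
Variables (R : comNzRingType) (p : nat).
Hypothesis chR : p \in [pchar R].

(* The [R]-module R^{1/p^e}: the element [s] of the carrier stands for the root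
   s^{1/p^e}, so that r . s^{1/p^e} = (r^{p^e} s)^{1/p^e}. *)
Definition root_module of p \in [pchar R] := fun e : nat => (R : Type).

HB.instance Definition _ e := GRing.Zmodule.on (root_module chR e).

Definition root_scale e (r : R) (s : root_module chR e) : root_module chR e :=
  r ^+ (p ^ e) * (s : R).

Lemma root_scaleA e (a b : R) (v : root_module chR e) :
  root_scale a (root_scale b v) = root_scale (a * b) v.
Proof. by rewrite /root_scale exprMn mulrA. Qed.

Lemma root_scale1 e : left_id 1 (@root_scale e).
Proof. by move=> v; rewrite /root_scale expr1n mul1r. Qed.

Lemma root_scaleDr e : right_distributive (@root_scale e) +%R.
Proof. by move=> a u v; rewrite /root_scale mulrDr. Qed.

Lemma root_scaleDl e (v : root_module chR e) :
  {morph (@root_scale e)^~ v : a b / a + b}.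
Proof.
move=> a b; rewrite /root_scale exprDn_pchar ?mulrDl //.
by rewrite pnatX (pnatE _ (pcharf_prime chR)) chR.
Qed.

HB.instance Definition _ e :=
  GRing.Zmodule_isLmodule.Build R (root_module chR e)
    (@root_scaleA e) (@root_scale1 e) (@root_scaleDr e) (@root_scaleDl e).

(* The inclusion of f^{1/p^e} R in R^{1/p^e} splits, where f^{1/p^e} R is the
   free module on f^{1/p^e}, i.e. the R-linear map R -> R^{1/p^e} sending 1 to
   f^{1/p^e} has an R-linear left inverse. Were f^{1/p^e} R only the cyclic
   submodule, f = 0 would satisfy the condition and every pair be F-pure. *)
Definition root_splits (e : nat) (f : R) : Prop :=
  exists phi : {linear root_module chR e -> R^o},
    cancel (fun r : R => r *: (f : root_module chR e)) phi.

Definition Fpure_pair (RR : realType) (I : set R) (lam : RR) : Prop :=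
  exists e0 : nat, forall e : nat, (e0 <= e)%N ->
    exists2 f : R,
      ideal_exp I (Num.truncn ((p ^ e - 1)%N%:R * lam)) f & root_splits e f.

(* As a supremum in the extended reals, so that no value is arbitrary: the set
   is empty exactly when it yields -oo, and unbounded when it yields +oo. *)
Definition fpt_ideal (RR : realType) (I : set R) : \bar RR :=
  ereal_sup [set lam%:E | lam in [set lam : RR | 0 <= lam /\ Fpure_pair I lam]].

End FpurePairs.

Section GradedQuotients.
Variables (K : fieldType) (N : nat).
Implicit Type I : idealr {mpoly K[N]}.

Definition homogeneous_max I : set {ideal_quot I} :=
  ideal_gen [set \pi_({ideal_quot I})%qT ('X_i : {mpoly K[N]}) | i in [set: 'I_N]].

Lemma pchar_quot I p : p \in [pchar K] -> p \in [pchar {ideal_quot I}].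
Proof.
move=> chK; apply: (rmorph_pchar (\pi_({ideal_quot I})%qT)).
by apply: (rmorph_pchar (@mpolyC N K)).
Qed.

Definition fpt (RR : realType) (p : nat) (chK : p \in [pchar K]) I : \bar RR :=
  fpt_ideal (pchar_quot I chK) RR (@homogeneous_max I).

(* Lexicographic order in which the variable of smallest index is the largest. *)
Definition lex_lt (m1 m2 : 'X_{1..N}) : Prop :=
  exists i : 'I_N, (m1 i < m2 i)%N /\ forall j : 'I_N, (j < i)%N -> m1 j = m2 j.

Definition lex_lead (f : {mpoly K[N]}) (m : 'X_{1..N}) : Prop :=
  m \in msupp f /\ forall m', m' \in msupp f -> m' = m \/ lex_lt m' m.

Definition initial_monomials I : set {mpoly K[N]} :=
  [set g | exists f m, [/\ f \in I, lex_lead f m & g = 'X_[m]]].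

Lemma ideal_gen_mcoeff0 (A : set {mpoly K[N]}) :
  (forall g, A g -> g@_0%MM = 0) -> ~ ideal_gen A 1.
Proof.
move=> A0 [k [a [g [Ag /(congr1 (mcoeff 0%MM))]]]].
rewrite mcoeff1 eqxx raddf_sum big1 => [/eqP|i _ /=]; first by rewrite oner_eq0.
by rewrite (rmorphM (@mcoeff N K 0%MM)) /= (A0 _ (Ag i)) mulr0.
Qed.

Lemma initial_ideal_proper I : ~ ideal_gen (initial_monomials I) 1.
Proof.
apply: ideal_gen_mcoeff0 => g [f [m [fI [mf lead] ->]]].
rewrite mcoeffX; case: eqP => // m0; exfalso; subst m.
have supp m' : m' \in msupp f -> m' = 0%MM.
  by move=> /lead[//|[i []]]; rewrite mnm0E.
have fC : f = (f@_0%MM)%:MP.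
  apply/mpolyP=> m'; rewrite mcoeffC.
  case: (boolP (m' \in msupp f)) => [/supp -> | nm].
    by rewrite eqxx mulr1.
  rewrite (memN_msupp_eq0 nm); case: eqP => [E|_]; last by rewrite mulr0.
  by rewrite E mf in nm.
have f0 : f@_0%MM != 0 by rewrite -mcoeff_msupp.
have : (f@_0%MM)^-1%:MP * f \in I by apply: idealMr.
by rewrite {2}fC -mpolyCM mulVf // idealr1.
Qed.

Definition initial_ideal I : idealr {mpoly K[N]} :=
  generated_ideal (@initial_ideal_proper I).

End GradedQuotients.

Section BinomialEdgeIdeals.
Variables (K : fieldType) (n : nat).

(* The variables are ordered as x_1, ..., x_n, y_1, ..., y_n. *)
Definition xvar (i : 'I_n) : {mpoly K[n + n]} := 'X_(lshift n i).
Definition yvar (i : 'I_n) : {mpoly K[n + n]} := 'X_(rshift n i).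

Definition edge_binomial (i j : 'I_n) : {mpoly K[n + n]} :=
  xvar i * yvar j - xvar j * yvar i.

Definition edge_binomials (G : rel 'I_n) : set {mpoly K[n + n]} :=
  [set f | exists i j : 'I_n, [/\ (i < j)%N, G i j & f = edge_binomial i j]].

Lemma edge_ideal_proper G : ~ ideal_gen (edge_binomials G) 1.
Proof.
apply: ideal_gen_mcoeff0 => g [i [j [_ _ ->]]].
rewrite /edge_binomial /xvar /yvar mcoeffB -!mpolyXD !mcoeffX.
have U0 (a b : 'I_(n + n)) : (U_(a) + U_(b) == 0 :> 'X_{1..(n + n)})%MM = false.
  by apply/eqP => /mnmP/(_ a); rewrite mnmDE mnm0E mnm1E eqxx.
by rewrite !U0 subr0.
Qed.

Definition binomial_edge_ideal (G : rel 'I_n) : idealr {mpoly K[n + n]} :=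
  generated_ideal (@edge_ideal_proper G).

End BinomialEdgeIdeals.

Definition simple_graph (n : nat) (G : rel 'I_n) : Prop :=
  ssrbool.symmetric G /\ irreflexive G.

(* Closedness with respect to the given labelling 1 < ... < n of the vertices,
   the one that also orders the variables. *)
Definition closed_labelling (n : nat) (G : rel 'I_n) : Prop :=
  forall i j k l : 'I_n, (i < j)%N -> (k < l)%N -> G i j -> G k l ->
    (i, j) <> (k, l) -> (i = k -> G j l) /\ (j = l -> G i k).

(* Main.v *)
(* Write q = p^e, J for the binomial edge ideal and R for its quotient or that of
   its initial ideal.  Both thresholds equal the number t of variables x_i, y_j
   that do not occur in the initial monomials x_i y_j (i < j an edge): t counts
   the vertices without larger neighbour and those without smaller neighbour.

   A splitting of f^(1/q) with f in m^N forces N <= t (q - 1).  Let phi be a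
   p^-e-linear map on R and r a monomial of degree > t (q - 1); it suffices that
   phi(r) has zero constant term.  For the initial ideal, either a variable occurs
   in r with exponent >= q, or r is divisible by some x_i (or y_j) with x_i y_j = 0,
   and then y_j phi(r) = phi(y_j^q r) = 0.  For J, iterating "least larger
   neighbour" sends every vertex i to a vertex T without larger neighbour, and
   x_i y_T = x_T y_i in R up to a factor that is a product of x's.  By pigeonhole r
   has degree >= q in the x's (say) of the vertices above one T, so
   y_T^q r = x_T^q r' and y_T phi(r) = x_T phi(r') up to such a factor; specializing
   all x_i to s and all y_i to t shows that phi(r) has no constant term.

   Conversely let g be the product of f_(i,next i)^(q-1) over the vertices with a
   larger neighbour, next i being the least one.  As the labelling is closed, next
   is a bijection onto the vertices with a smaller neighbour, so g times the
   (q-1)-th power of the free variables has lexicographic leading monomial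
   (prod of all variables)^(q-1), and the trace F |-> Tr(g F) splits.  It preserves
   J: for an edge a < l the vertices joined to l from below form with l a clique A
   stable under next, x^k f_al is in (f_(i,next i) : i in A, i <> l) for some
   monomial x^k, and the ideal of the clique is the kernel of a map to a domain, in
   which x^k can be cancelled.  Taking leading terms, Tr(in(g) .) preserves the
   initial ideal. *)

From HB Require Import structures.
Require Import Defs.
From mathcomp Require Import all_boot all_order all_algebra.
From mathcomp Require Import generic_quotient ring_quotient.
From mathcomp Require Import mpoly.
From mathcomp Require Import boolp classical_sets reals constructive_ereal ereal.
From mathcomp Require Import zify ring.

Set Implicit Arguments.
Unset Strict Implicit.
Unset Printing Implicit Defensive.

Import Order.TTheory GRing.Theory Num.Theory.

Local Open Scope classical_set_scope.
Local Open Scope ring_scope.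

(** * Generators of ideals and of their powers *)

Section IdealPowers.
Variable R : comNzRingType.
Implicit Types A I : set R.

Definition ideal_like (Q : R -> Prop) :=
  [/\ Q 0, (forall u v, Q u -> Q v -> Q (u + v)) & (forall a u, Q u -> Q (a * u))].

Lemma ideal_gen_min A (Q : R -> Prop) :
  ideal_like Q -> (forall g, A g -> Q g) -> forall f, ideal_gen A f -> Q f.
Proof.
move=> [Q0 QD QM] QA f [k [a [g [Ag ->]]]].
by elim/big_ind: _ => // i _; apply/QM/QA.
Qed.

Lemma ideal_gen_like A : ideal_like (ideal_gen A).
Proof.
split.
- by exists 0%N, (fun=> 0), (fun=> 0); split=> [[]|]; rewrite ?big_ord0.
- move=> u v [k [a [g [Ag ->]]]] [l [b [h [Ah ->]]]].
  exists (k + l)%N,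
    (fun i => match split i with inl i => a i | inr i => b i end),
    (fun i => match split i with inl i => g i | inr i => h i end); split.
    by move=> i; case: (split i).
  rewrite big_split_ord /=; congr (_ + _); apply: eq_bigr => i _.
    by rewrite (unsplitK (inl i)).
  by rewrite (unsplitK (inr i)).
- move=> c u [k [a [g [Ag ->]]]]; exists k, (fun i => c * a i), g; split=> //.
  by rewrite mulr_sumr; apply: eq_bigr => i _; rewrite mulrA.
Qed.

Lemma mem_ideal_gen A g : A g -> ideal_gen A g.
Proof.
move=> Ag; exists 1%N, (fun=> 1), (fun=> g); split=> //.
by rewrite big_ord1 mul1r.
Qed.

Lemma mem_generated_ideal A (A1 : ~ ideal_gen A 1) f :
  (f \in generated_ideal A1) <-> ideal_gen A f.
Proof. by split=> [/asboolP|H]; last apply/asboolP. Qed.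

(** Multilinearity: the factors of a product of N elements of the ideal are expanded in generators
    one at a time, which is harmless as [Q] is stable under sums and multiples. *)
Lemma ideal_exp_gen_min A N (Q : R -> Prop) : ideal_like Q ->
  (forall h : 'I_N -> R, (forall i, A (h i)) -> Q (\prod_(i < N) h i)) ->
  forall f, ideal_exp (ideal_gen A) N f -> Q f.
Proof.
move=> Qid QA; apply: ideal_gen_min => // _ [g [gA ->]].
elim: N Q Qid QA g gA => [|N IH] Q Qid QA g gA.
  by have /QA : forall i : 'I_0, A (g i) by case.
rewrite big_ord_recl; have [Q0 QD QM] := Qid.
(* The first factor is kept fixed while the induction hypothesis replaces the others by generators;
   it is expanded afterwards. *)
apply: (IH (fun r => Q (g ord0 * r)) _ _ (fun i => g (lift ord0 i))) => //.
  by split=> [|u v|a u]; rewrite ?mulr0 ?mulrDr // ?(mulrCA _ a); auto.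
move=> h hA; apply: (@ideal_gen_min _ (fun r => Q (r * _)) _ _ _ (gA ord0)).
  by split=> [|u v|a u]; rewrite ?mul0r ?mulrDl -?mulrA //; auto.
move=> x Ax; pose h' i := if unlift ord0 i is Some j then h j else x.
have -> : x * \prod_(i < N) h i = \prod_(i < N.+1) h' i.
  rewrite big_ord_recl /h' unlift_none; congr (_ * _).
  by apply: eq_bigr => i _; rewrite liftK.
by apply: QA => i; rewrite /h'; case: unlift.
Qed.

End IdealPowers.

(** * Computing an F-pure threshold from bounds valid for every e *)

Section Threshold.
Variables (R : comNzRingType) (p : nat) (chR : p \in [pchar R]) (RR : realType).
Variables (A : set R) (t : nat).
Local Notation m := (ideal_gen A).

Lemma fpt_ideal_eq :
    (forall e f N, ideal_exp m N f -> root_splits chR e f ->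
       (N <= t * (p ^ e - 1))%N) ->
    (forall e, exists2 f, ideal_exp m (t * (p ^ e - 1)) f & root_splits chR e f) ->
  fpt_ideal chR RR m = (t%:R : RR)%:E.
Proof.
move=> upper lower; have p1 : (1 < p)%N := prime_gt1 (pcharf_prime chR).
apply/le_anti/andP; split; last first.
  apply: ereal_sup_ubound; exists t%:R => //; split=> //.
  exists 0%N => e _; have [f fm fs] := lower e; exists f => //.
  by rewrite -natrM natrK mulnC.
apply: ge_ereal_sup => _ [lam [lam0 [e0 He]] <-]; rewrite lee_fin leNgt; apply/negP.
(* For q = p^(e0 + k) one has q - 1 >= k, so (q - 1) (lam - t) > 1 and the integer part of (q - 1)
   lam exceeds t (q - 1). *)
rewrite -subr_gt0 => d0; have [k kd] : exists k : nat, 1 < k%:R * (lam - t%:R).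
  by exists (Num.truncn (lam - t%:R)^-1).+1; rewrite -ltr_pdivrMr // mul1r truncnS_gt.
have [f fm fs] := He _ (leq_addr k e0).
have := upper _ _ _ fm fs; apply/negP; rewrite -ltnNge.
have q1 : (k <= p ^ (e0 + k) - 1)%N.
  have : (e0 + k < p ^ (e0 + k))%N by apply: ltn_expl.
  by rewrite leq_subRL ?expn_gt0 ?(ltnW p1) // add1n; apply: leq_ltn_trans; exact: leq_addl.
set q := (p ^ (e0 + k) - 1)%N in q1 *.
rewrite truncn_gt_nat -natr1 natrM -lerBrDl (mulrC t%:R) -mulrBr.
by rewrite (le_trans (ltW kd)) // ler_wpM2r ?ler_nat // ltW.
Qed.

End Threshold.

(** * Splittings of the iterated Frobenius of an F-finite field *)

Section FrobeniusSplitting.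
Variables (K : fieldType) (p : nat) (chK : p \in [pchar K]).

Local Notation F := (pFrobenius_aut chK).

(** A spanning family of least length is linearly independent over the p-th powers, so the p-th
    roots [c a i] of the coordinates are unique. *)
Lemma frobenius_basis : F_finite p K ->
  exists (k : nat) (b : 'I_k -> K) (c : K -> 'I_k -> K),
    (forall a, a = \sum_(i < k) c a i ^+ p * b i) /\
    forall a d, a = \sum_(i < k) d i ^+ p * b i -> d =1 c a.
Proof.
move=> fin.
have ex : exists k, `[< exists b : 'I_k -> K,
    forall a : K, exists c : 'I_k -> K, a = \sum_(i < k) c i ^+ p * b i >].
  by have [k H] := fin; exists k; apply/asboolP.
case: (ex_minnP ex) => k /asboolP[b /choice[c bc]] kmin.
have indep d : \sum_(i < k) d i ^+ p * b i = 0 -> d =1 fun=> 0.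
  move=> d0 j; apply/eqP/negPn/negP => dj.
  case: k b c kmin d d0 j dj bc => [|k] b c kmin d d0 j dj bc; first by case: j dj.
  suff: (k.+1 <= k)%N by rewrite ltnn.
  apply/kmin/asboolP; exists (b \o lift j) => a.
  exists (fun i => c a (lift j i) - c a j * (d (lift j i) / d j)).
  (* A nonzero [d j] expresses [b j] through the other vectors, which then still span, against
     minimality. *)
  have bj : b j = - \sum_(i < k) F (d (lift j i) / d j) * b (lift j i).
    have := congr1 ( *%R (F (d j))^-1) d0.
    rewrite (bigD1_ord j) //= mulrDr mulr0 pFrobenius_autE mulKf ?expf_neq0 //.
    move/eqP; rewrite addr_eq0 => /eqP->; congr (- _); rewrite mulr_sumr.
    by apply: eq_bigr => i _; rewrite pFrobenius_autE expr_div_n mulrA [_^-1 * _]mulrC.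
  rewrite {1}[a]bc (bigD1_ord j) //= bj mulrN addrC mulr_sumr -sumrB.
  apply: eq_bigr => i _; rewrite -!pFrobenius_autE rmorphB /= mulrBl.
  by rewrite [F (_ * (_ / _))]rmorphM mulrA.
exists k, b, c; split=> // a d ad i; apply/eqP; rewrite -subr_eq0; apply/eqP.
apply: (indep (fun i => d i - c a i)).
transitivity (\sum_(l < k) d l ^+ p * b l - \sum_(l < k) c a l ^+ p * b l);
  last by rewrite -ad -bc subrr.
rewrite -sumrB; apply: eq_bigr => l _.
by rewrite -!pFrobenius_autE rmorphB mulrBl.
Qed.

Definition frobenius_splitting q (psi : K -> K) :=
  [/\ (forall a b, psi (a + b) = psi a + psi b),
      (forall c a, psi (c ^+ q * a) = c * psi a) & psi 1 = 1].

(** For p itself, take [c a i] at an index where 1 has a nonzero coordinate and divide by [c 1 i];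
    then compose e times. *)
Lemma frobenius_splitting_exists e : F_finite p K ->
  exists psi, frobenius_splitting (p ^ e) psi.
Proof.
move=> /frobenius_basis [k [b [c [bc cU]]]].
have [i ci] : exists i, c 1 i != 0.
  apply/not_existsP => H; have := oner_neq0 K; rewrite [1]bc big1 ?eqxx // => i _.
  by have /negP/negPn/eqP-> := H i; rewrite expr0n gtn_eqF ?mul0r // prime_gt0 ?(pcharf_prime chK).
have [psi [psiD psiZ psi1]] : exists psi, frobenius_splitting p psi.
  exists (fun a => c a i / c 1 i); split=> [u v|x a|]; last by rewrite divff.
    rewrite -mulrDl; congr (_ / _); apply/esym/(cU _ (fun i => c u i + c v i)).
    rewrite {1}[u]bc {1}[v]bc -big_split; apply: eq_bigr => l _ /=.
    by rewrite -!pFrobenius_autE rmorphD mulrDl.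
  rewrite mulrA; congr (_ / _); apply/esym/(cU _ (fun i => x * c a i)).
  by rewrite {1}[a]bc mulr_sumr; apply: eq_bigr => l _; rewrite exprMn mulrA.
elim: e => [|e [phi [phiD phiZ phi1]]].
  by exists id; split=> // x a; rewrite expr1.
exists (psi \o phi); split=> [u v|x a|] /=; rewrite ?phiD ?phi1 //.
by rewrite expnS exprM phiZ psiZ.
Qed.

End FrobeniusSplitting.

(** * Lexicographic leading monomials *)

Section LexLead.
Variables (K : fieldType) (N : nat).
Implicit Types (f g : {mpoly K[N]}) (m : 'X_{1..N}).

Lemma lex_lt_irr m : ~ lex_lt m m.
Proof. by case=> i []; rewrite ltnn. Qed.

Lemma lex_lt_trans m2 m1 m3 : lex_lt m1 m2 -> lex_lt m2 m3 -> lex_lt m1 m3.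
Proof.
move=> [i [lti eqi]] [j [ltj eqj]].
case: (ltngtP i j) => [ij|ji|/val_inj ij].
- by exists i; rewrite -(eqj i ij); split=> // k ki; rewrite eqi // eqj // (ltn_trans ki).
- by exists j; rewrite (eqi j ji); split=> // k kj; rewrite -eqj // eqi // (ltn_trans kj).
- subst j; exists i; split; first exact: ltn_trans ltj.
  by move=> k ki; rewrite eqi // eqj.
Qed.

Lemma lex_lt_add2r m m1 m2 : lex_lt m1 m2 -> lex_lt (m1 + m)%MM (m2 + m)%MM.
Proof.
move=> [i [lti eqi]]; exists i; rewrite !mnmDE ltn_add2r; split=> // j /eqi.
by rewrite !mnmDE => ->.
Qed.

Definition lex_below f m := forall m', m' \in msupp f -> lex_lt m' m.

Lemma lex_belowD f g m : lex_below f m -> lex_below g m -> lex_below (f + g) m.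
Proof. by move=> fm gm m' /msuppD_le; rewrite mem_cat => /orP[/fm|/gm]. Qed.

Lemma lex_belowM f g m1 m2 :
  lex_below f m1 -> lex_below g m2 -> lex_below (f * g) (m1 + m2)%MM.
Proof.
move=> fm gm m /msuppM_le/allpairsP[[a b] /= [/fm am /gm bm ->]].
apply: (lex_lt_trans (lex_lt_add2r b am)).
by rewrite ![(m1 + _)%MM]addmC; apply: lex_lt_add2r.
Qed.

Lemma lex_belowMX f m1 m2 : lex_below f m1 -> lex_below (f * 'X_[m2]) (m1 + m2)%MM.
Proof.
move=> fm m /msuppM_le/allpairsP[[a b] /= [/fm am]].
by rewrite msuppX inE => /eqP-> ->; apply: lex_lt_add2r.
Qed.

(** Normalized to leading coefficient 1, so that leading terms multiply without scalars. *)
Definition lex_monic f m := exists2 r, f = 'X_[m] + r & lex_below r m.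

Lemma lex_monicX m : lex_monic 'X_[m] m.
Proof. by exists 0; rewrite ?addr0 // => m'; rewrite msupp0. Qed.

Lemma lex_monicM f g m1 m2 :
  lex_monic f m1 -> lex_monic g m2 -> lex_monic (f * g) (m1 + m2)%MM.
Proof.
move=> [r -> rb] [s -> sb].
exists ('X_[m1] * s + r * 'X_[m2] + r * s).
  by rewrite mulrDl !mulrDr -mpolyXD !addrA.
apply: lex_belowD; last exact: lex_belowM.
apply: lex_belowD; last exact: lex_belowMX.
by rewrite mulrC addmC; apply: lex_belowMX.
Qed.

Lemma lex_monic_prod (I : Type) (r : seq I) (P : pred I) (F : I -> {mpoly K[N]}) M :
  (forall i, P i -> lex_monic (F i) (M i)) ->
  lex_monic (\prod_(i <- r | P i) F i) (\sum_(i <- r | P i) M i)%MM.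
Proof.
move=> FM; elim/big_rec2: _ => [|i m f Pi fm]; last exact: lex_monicM (FM i Pi) fm.
by rewrite -mpolyX0; apply: lex_monicX.
Qed.

Lemma lex_monicXn f m k : lex_monic f m -> lex_monic (f ^+ k) (m *+ k)%MM.
Proof.
move=> fm; elim: k => [|k IH]; first by rewrite expr0 mulm0n -mpolyX0; apply: lex_monicX.
by rewrite exprS mulmS; apply: lex_monicM.
Qed.

Lemma lex_monic_coeff f m : lex_monic f m -> f@_m = 1.
Proof.
move=> [r -> rb]; rewrite mcoeffD mcoeffX eqxx memN_msupp_eq0 ?addr0 //.
by apply/negP => /rb/lex_lt_irr.
Qed.

Lemma lex_monic_lead f m : lex_monic f m -> lex_lead f m.
Proof.
move=> fm; split; first by rewrite mcoeff_msupp (lex_monic_coeff fm) oner_neq0.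
case: fm => r -> rb m' /msuppD_le; rewrite mem_cat msuppX inE => /orP[/eqP|/rb]; by [left|right].
Qed.

Lemma lex_lead_monic f m : lex_lead f m -> lex_monic ((f@_m)^-1 *: f) m.
Proof.
move=> [mf lead]; have fm0 : f@_m != 0 by rewrite -mcoeff_msupp.
exists ((f@_m)^-1 *: f - 'X_[m]); first by rewrite addrC subrK.
move=> m' m's; have ne : m' != m.
  apply: contraTneq m's => ->; rewrite -mcoeff_eq0 mcoeffB mcoeffZ mcoeffX eqxx.
  by rewrite mulVf // subrr.
move: m's => /msuppB_le; rewrite mem_cat msuppX inE (negPf ne) orbF => /msuppZ_le.
by case/lead => [/eqP|//]; rewrite (negPf ne).
Qed.

End LexLead.

(** * The p^-e-linear trace on the polynomial ring *)

Section Trace.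
Variables (K : fieldType) (N p : nat) (chK : p \in [pchar K]) (e : nat).
Local Notation q := (p ^ e)%N.
Variable psi : K -> K.
Hypothesis psiP : frobenius_splitting q psi.

Let psiD a b : psi (a + b) = psi a + psi b. Proof. by case: psiP. Qed.
Let psiZ c a : psi (c ^+ q * a) = c * psi a. Proof. by case: psiP. Qed.
Let psi1 : psi 1 = 1. Proof. by case: psiP. Qed.
Let q_gt0 : (0 < q)%N.
Proof. by rewrite expn_gt0 prime_gt0 ?(pcharf_prime chK). Qed.
Let psi0 : psi 0 = 0.
Proof. by have := psiZ 0 0; rewrite mulr0 mul0r. Qed.

Local Notation S := {mpoly K[N]}.
Implicit Types (F G : S) (m mu : 'X_{1..N}).

Definition top_mnm : 'X_{1..N} := [multinom q.-1 | i < N].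

Definition trace_mnm mu : 'X_{1..N} := (mu *+ q + top_mnm)%MM.

(* The p^-e-linear map sending c z^(q mu + q-1) to psi(c) z^mu and the monomials
   of any other form to 0. *)
Definition trace F : S :=
  \sum_(m <- msupp F | trace_mnm [multinom (m i %/ q)%N | i < N] == m)
     psi F@_m *: 'X_[[multinom (m i %/ q)%N | i < N]].

Lemma trace_mnmK mu : [multinom (trace_mnm mu i %/ q)%N | i < N] = mu.
Proof.
apply/mnmP => i; rewrite mnmE mnmDE mulmnE mnmE divnMDl // divn_small ?addn0 //.
by rewrite prednK.
Qed.

Lemma trace_mnm_inj : injective trace_mnm.
Proof. by move=> m m' H; rewrite -[m]trace_mnmK H trace_mnmK. Qed.

Lemma mcoeff_trace F mu : (trace F)@_mu = psi F@_(trace_mnm mu).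
Proof.
rewrite /trace raddf_sum /=.
case: (boolP (trace_mnm mu \in msupp F)) => [muF|nF].
  rewrite big_mkcond (bigD1_seq (trace_mnm mu)) ?msupp_uniq //= trace_mnmK eqxx.
  rewrite mcoeffZ mcoeffX eqxx mulr1 big1 ?addr0 // => m ne.
  case: eqP => // Em; rewrite mcoeffZ mcoeffX.
  by case: eqP => [E|_]; rewrite ?mulr0 //; rewrite -Em E eqxx in ne.
rewrite (memN_msupp_eq0 nF) psi0 big_seq_cond big1 // => m /andP[mF /eqP Em].
rewrite mcoeffZ mcoeffX; case: eqP => [E|_]; rewrite ?mulr0 //.
by rewrite -E Em mF in nF.
Qed.

Lemma traceD F G : trace (F + G) = trace F + trace G.
Proof. by apply/mpolyP=> m; rewrite mcoeffD !mcoeff_trace mcoeffD psiD. Qed.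

Lemma trace0 : trace 0 = 0.
Proof. by apply/mpolyP=> m; rewrite mcoeff_trace !mcoeff0 psi0. Qed.

Lemma trace_mnmD mu nu : trace_mnm (mu + nu) = (trace_mnm mu + nu *+ q)%MM.
Proof. by apply/mnmP=> i; rewrite !(mnmDE, mulmnE) mulnDl addnAC. Qed.

Lemma mcoeffMX_notle F m mu : ~~ (m <= mu)%MM -> (F * 'X_[m])@_mu = 0.
Proof.
move=> H; apply: memN_msupp_eq0; apply: contra H => /msuppM_le/allpairsP[[a b] /= [_]].
by rewrite msuppX inE => /eqP -> ->; apply: lem_addl.
Qed.

(** The q-th power is additive, so G may be a single term c z^m; multiplying by z^(q m) shifts the
    exponent q mu + q - 1 to q (mu + m) + q - 1. *)
Lemma trace_expM G F : trace (G ^+ q * F) = G * trace F.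
Proof.
have qnat : [pchar S].-nat q.
  rewrite pnatX (pnatE _ (pcharf_prime chK)).
  by rewrite (rmorph_pchar (@mpolyC N K) chK).
elim/mpolyind: G => [|c m G _ _ IH]; first by rewrite expr0n gtn_eqF // !mul0r trace0.
rewrite exprDn_pchar // !mulrDl traceD IH; congr (_ + _).
rewrite exprZn mpolyXn -!scalerAl ![_ * F]mulrC [_ * trace F]mulrC.
apply/mpolyP => mu; rewrite mcoeffZ mcoeff_trace mcoeffZ psiZ; congr (_ * _).
case: (boolP (m <= mu)%MM) => [/submK <-|nle].
  by rewrite trace_mnmD addmC mcoeffMX addmC mcoeffMX mcoeff_trace.
(* If m_i >= mu_i + 1 for some i, then q m_i > q mu_i + q - 1, so neither side has a term at mu. *)
rewrite mcoeffMX_notle ?psi0 ?mcoeffMX_notle //; apply: contra nle => /mnm_lepP H.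
apply/mnm_lepP => i; have := H i; rewrite mnmDE !mulmnE mnmE => le.
rewrite leqNgt; apply/negP => lt.
have := leq_trans (leq_mul lt (leqnn q)) le.
by rewrite mulSn addnC leq_add2l leqNgt prednK // leqnn.
Qed.

(** Every exponent q mu + q - 1 with mu nonzero is lexicographically above [top_mnm], so only mu = 0
    contributes. *)
Lemma trace_top F : lex_monic F top_mnm -> trace F = 1.
Proof.
move=> Fm; apply/mpolyP=> mu; rewrite mcoeff_trace mcoeff1.
have e0 : trace_mnm 0%MM = top_mnm.
  by apply/mnmP => i; rewrite mnmDE mulmnE mnm0E.
case: eqP => [->|mu0]; first by rewrite e0 (lex_monic_coeff Fm) psi1.
rewrite memN_msupp_eq0 ?psi0 //; apply/negP => /(lex_monic_lead Fm).2[|].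
  by rewrite -e0 => /trace_mnm_inj.
case=> i [+ _]; rewrite mnmDE mulmnE mnmE -[X in (_ < X)%N]add0n ltn_add2r //.
Qed.

(** The map sending mu to q mu + q - 1 reflects [lex_lt], and the leading coefficient survives
    because psi 1 = 1. *)
Lemma lex_lead_trace F mu : lex_monic F (trace_mnm mu) -> lex_lead (trace F) mu.
Proof.
move=> Fm; split.
  by rewrite mcoeff_msupp mcoeff_trace (lex_monic_coeff Fm) psi1 oner_neq0.
move=> nu; rewrite mcoeff_msupp mcoeff_trace => nz.
have : trace_mnm nu \in msupp F by rewrite mcoeff_msupp; apply: contraNneq nz => ->; rewrite psi0.
case/(lex_monic_lead Fm).2 => [/trace_mnm_inj|[i [lt eqi]]]; [by left|right].
exists i; split=> [|j /eqi]; rewrite !(mnmDE, mulmnE) in lt *.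
  by move: lt; rewrite ltn_add2r ltn_pmul2r.
by move/addIn/eqP; rewrite eqn_pmul2r // => /eqP.
Qed.

End Trace.

(** * Splittings and degree bounds for quotients of the polynomial ring *)

Section QuotientSplittings.
Variables (K : fieldType) (N p : nat) (chK : p \in [pchar K]).
Local Notation S := {mpoly K[N]}.
Variable I : idealr S.
Local Notation R := {ideal_quot I}.
Local Notation pi := (\pi_({ideal_quot I})%qT : S -> R).
Local Notation chR := (pchar_quot I chK).

Lemma pi_eq (a b : S) : pi a = pi b <-> a - b \in I.
Proof. by rewrite (Quotient.idealrBE I); split=> /eqP. Qed.

Lemma pi_eq0 (a : S) : pi a = 0 <-> a \in I.
Proof. by rewrite -[a in a \in I]subr0 -pi_eq rmorph0. Qed.

Lemma pi_mulr (a b : S) : pi (a * b) = pi a * pi b.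
Proof. exact: rmorphM. Qed.

Lemma reprB_ideal (a : S) : repr (pi a) - a \in I.
Proof. by apply/pi_eq; rewrite reprK. Qed.

(** Since Tr(g .) preserves I, it descends to a p^-e-linear map on the quotient, and this map sends
    the class of f to 1. *)
Lemma root_splits_trace e psi g f : frobenius_splitting (p ^ e) psi ->
    (forall j, j \in I -> trace p e psi (g * j) \in I) ->
  trace p e psi (g * f) = 1 -> root_splits chR e (pi f).
Proof.
move=> psiP gI gf1; pose tr : S -> S := @trace K N p e psi.
pose phi (r : root_module chR e) : R^o := pi (tr (g * repr (r : R))).
have phi_pi a : phi (pi a) = pi (tr (g * a)).
  apply/eqP; rewrite -subr_eq0 -rmorphB; apply/eqP/pi_eq0.
  have -> : tr (g * repr (pi a)) = tr (g * (repr (pi a) - a)) + tr (g * a).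
    by rewrite /tr -traceD // -mulrDr subrK.
  by rewrite addrK; apply/gI/reprB_ideal.
have phiD : {morph phi : u v / u + v}.
  move=> u v; rewrite -[u](reprK (u : R)) -[v](reprK (v : R)).
  have -> : ((pi (repr (u : R)) : root_module chR e) + pi (repr (v : R)))
    = pi (repr (u : R) + repr (v : R)) by rewrite rmorphD.
  by rewrite !phi_pi mulrDr /tr traceD // rmorphD.
have phiZ c (u : R) : phi (c ^+ (p ^ e) * u) = c * phi u.
  rewrite -[c]reprK -[u]reprK -rmorphXn -rmorphM !phi_pi mulrCA /tr.
  by rewrite trace_expM // rmorphM.
have lin : linear phi.
  by move=> c u v; rewrite phiD; congr (_ + _); apply: phiZ.
pose linB := GRing.isLinear.Build _ _ _ _ phi lin.
pose phiL : {linear root_module chR e -> R^o} := HB.pack phi linB.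
exists phiL => r; rewrite /phiL /=.
by rewrite [LHS]phiZ phi_pi /tr gf1 rmorph1 mulr1.
Qed.

(* A splitting, composed with the projection from [S]. *)
Definition cartier_map e (rho : S -> R) :=
  [/\ (forall a b, rho (a + b) = rho a + rho b),
      (forall c a, rho (c ^+ (p ^ e) * a) = pi c * rho a) &
      (forall a, a \in I -> rho a = 0)].

(** Membership in the homogeneous maximal ideal, stated through a representative. *)
Definition null_constant (r : R) := exists2 w : S, w@_0%MM = 0 & r = pi w.

Definition cartier_degree_bound e t :=
  forall rho, cartier_map e rho -> forall (m : 'X_{1..N}) (a : S), (t < mdeg m)%N ->
    null_constant (rho (a * 'X_[m])).

(** A splitting sends f to 1, whereas for M > t the bound would put this value into the homogeneous
    maximal ideal; by [ideal_exp_gen_min] it is enough to look at products of M variables. *)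
Lemma root_splits_degree e f M t :
    (forall a, a \in I -> a@_0%MM = 0) -> cartier_degree_bound e t ->
  ideal_exp (@homogeneous_max K N I) M f -> root_splits chR e f -> (M <= t)%N.
Proof.
move=> I0 bound fM [phi phiK]; rewrite leqNgt; apply/negP => tM.
pose rho (a : S) : R := phi (pi a).
have rhoP : cartier_map e rho.
  split=> [a b|c a|a /pi_eq0 aI].
  - by rewrite /rho rmorphD [LHS](raddfD phi).
  - rewrite /rho rmorphM rmorphXn.
    exact: (linearZ_LR phi (pi c) (pi a : root_module chR e)).
  - by rewrite /rho aI [LHS](raddf0 phi).
have [w w0 Ew] : null_constant (phi f).
  (* Generalizing the factor 1 to any multiplier makes the property of f stable under
     multiplication. *)
  rewrite -[f]mul1r; move: {phiK} f fM 1.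
  apply: ideal_exp_gen_min => [|h hX c].
    split=> [c|u v Qu Qv c|a u Qu c].
    - by exists 0; rewrite ?mcoeff0 // mulr0 rmorph0 [LHS](raddf0 phi).
    - have [wu wu0 Eu] := Qu c; have [wv wv0 Ev] := Qv c.
      exists (wu + wv); rewrite ?mcoeffD ?wu0 ?wv0 ?addr0 //.
      transitivity (phi (c * u) + phi (c * v)); last by rewrite Eu Ev rmorphD.
      by rewrite mulrDr; apply: (raddfD phi).
    - by rewrite mulrA.
  have /choice[k hk] : forall i, exists k, h i = pi 'X_k.
    by move=> i; have [k _ <-] := hX i; exists k.
  rewrite -[c]reprK (eq_bigr _ (fun i _ => hk i)) -rmorph_prod -rmorphM mprodXE.
  by apply: bound rhoP _ _ _; rewrite mdeg_sum (eq_bigr _ (fun i _ => mdeg1 _)) sum1_card card_ord.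
have : pi 1 = pi w.
  have := phiK 1; rewrite scale1r => H.
  by rewrite rmorph1 -Ew -H.
move/pi_eq/I0/eqP; rewrite mcoeffB mcoeff1 eqxx w0 subr0 oner_eq0 //.
Qed.

Lemma mem_homogeneous_max_exp (m : 'X_{1..N}) :
  ideal_exp (@homogeneous_max K N I) (mdeg m) (pi 'X_[m]).
Proof.
move md: (mdeg m) => d; elim: d m md => [|d IH] m md.
  apply: mem_ideal_gen; exists (fun=> 1); split=> [[[]]|] //.
  by move/eqP: md; rewrite mdeg_eq0 => /eqP->; rewrite mpolyX0 rmorph1 big_ord0.
have [i mi] : exists i, m i != 0%N.
  apply/not_existsP => H; move: md; rewrite mdegE big1 // => i _.
  by apply/eqP/negPn/negP/H.
have Em : m = (U_(i) + (m - U_(i)))%MM by rewrite addmC submK // lep1mP.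
have d' : mdeg (m - U_(i)) = d by move: md; rewrite {1}Em mdegD mdeg1 add1n => -[].
have -> : pi 'X_[m] = pi 'X_i * pi 'X_[m - U_(i)] by rewrite {1}Em mpolyXD rmorphM.
have := IH _ d'; move: (pi 'X_[m - _]).
apply: (@ideal_gen_min _ _
  (fun r : R => ideal_exp (@homogeneous_max K N I) d.+1 (pi 'X_i * r))).
  have [Q0 QD QM] := ideal_gen_like [set f | exists g : 'I_d.+1 -> R,
     (forall i, homogeneous_max (g i)) /\ f = \prod_(i < d.+1) g i].
  split=> [|u v|a u]; rewrite ?mulr0 ?mulrDr ?(mulrCA _ a) //; [exact: QD|exact: QM].
move=> _ [g [gA ->]]; apply: mem_ideal_gen.
exists (fun j => if unlift ord0 j is Some l then g l else pi 'X_i); split=> [j|].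
  by case: unlift => [l|]; [exact: gA|apply: mem_ideal_gen; exists i].
rewrite big_ord_recl unlift_none; congr (_ * _).
by apply: eq_bigr => l _; rewrite liftK.
Qed.

Lemma fpt_eq (RR : realType) t :
    (forall a, a \in I -> a@_0%MM = 0) ->
    (forall e, cartier_degree_bound e (t * (p ^ e - 1))) ->
    (forall e, exists psi g m, [/\ frobenius_splitting (p ^ e) psi,
       (forall j, j \in I -> trace p e psi (g * j) \in I),
       trace p e psi (g * 'X_[m]) = 1 & mdeg m = (t * (p ^ e - 1))%N]) ->
  fpt RR chK I = (t%:R : RR)%:E.
Proof.
move=> I0 upper lower; apply: fpt_ideal_eq => e.
  by move=> f M fM fs; apply: root_splits_degree fM fs.
have [psi [g [m [psiP gI g1 <-]]]] := lower e.
exists (pi 'X_[m]); first exact: mem_homogeneous_max_exp.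
exact: root_splits_trace psiP gI g1.
Qed.

End QuotientSplittings.

(** * Initial ideals: degree bound and compatible traces *)

Section InitialIdeal.
Variables (K : fieldType) (N p : nat) (chK : p \in [pchar K]).
Local Notation S := {mpoly K[N]}.
Variable I : idealr S.
Local Notation pi := (\pi_({ideal_quot I})%qT : S -> {ideal_quot I}).

(** Constants are excluded as well. If z_l w has this property, its zero coefficient at z_l shows
    that w has no constant term. *)
Definition no_linear_terms (a : S) := forall m, m \in msupp a -> (1 < mdeg m)%N.

Lemma no_linear_terms_like : ideal_like no_linear_terms.
Proof.
split=> [m|u v Hu Hv m /msuppD_le|a u Hu m /msuppM_le/allpairsP[[x y] /= [_ /Hu y2 ->]]].
- by rewrite msupp0.
- by rewrite mem_cat => /orP[/Hu|/Hv].
- by rewrite mdegD (leq_trans y2) // leq_addl.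
Qed.

Lemma no_linear_terms_coeff a m : no_linear_terms a -> (mdeg m < 2)%N -> a@_m = 0.
Proof. by move=> aL m2; apply: memN_msupp_eq0; apply: contraL m2 => /aL; rewrite -ltnNge. Qed.

Lemma initial_no_linear_terms : (forall a, a \in I -> no_linear_terms a) ->
  forall a, a \in initial_ideal I -> no_linear_terms a.
Proof.
move=> IL a /mem_generated_ideal; apply: ideal_gen_min; first exact: no_linear_terms_like.
by move=> _ [f [m [fI [mf _] ->]]] m'; rewrite msuppX inE => /eqP->; apply: IL fI _ mf.
Qed.

Lemma mem_initial_ideal f m : f \in I -> lex_lead f m -> 'X_[m] \in initial_ideal I.
Proof. by move=> fI fm; apply/mem_generated_ideal/mem_ideal_gen; exists f, m. Qed.

(** [F] contains every variable without a quadratic monomial relation. When all exponents of m are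
    below q, those in [F] account for degree at most |F| (q - 1), so a variable outside [F]
    occurs. *)
Lemma cartier_degree_bound_quadratic e (F : {set 'I_N}) :
    (forall a, a \in I -> no_linear_terms a) ->
    (forall k, k \notin F -> exists l, ('X_k * 'X_l : S) \in I) ->
  cartier_degree_bound p I e (#|F| * (p ^ e - 1)).
Proof.
move=> IL IF rho [_ rhoZ rho0] m a dm.
have q_gt0 : (0 < p ^ e)%N by rewrite expn_gt0 prime_gt0 ?(pcharf_prime chK).
case: (boolP [exists k, p ^ e <= m k]%N) => [/existsP[k qk]|/existsPn small].
  have -> : a * 'X_[m] = 'X_k ^+ (p ^ e) * (a * 'X_[m - U_(k) *+ (p ^ e)]).
    rewrite mulrCA mpolyXn -mpolyXD addmC submK //.
    apply/mnm_lepP => i; rewrite mulmnE mnm1E; case: eqP => [<-|_]; by rewrite ?mul1n.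
  rewrite rhoZ; exists ('X_k * repr (rho (a * 'X_[m - U_(k) *+ (p ^ e)]))).
    by rewrite (rmorphM (@mcoeff N K 0%MM)) /= mcoeffX mnm1_eq0 mul0r.
  by rewrite pi_mulr reprK.
have [k kF mk] : exists2 k, k \notin F & m k != 0%N.
  apply/not_exists2P => H; move: dm; apply/negP; rewrite -leqNgt mdegE.
  rewrite (bigID (mem F)) /= [X in (_ + X)%N]big1 ?addn0.
    rewrite -sum_nat_const; apply: leq_sum => k _.
    by rewrite -ltnS subn1 prednK // ltnNge.
  by move=> k kF; case: (H k) => // /negP/negPn/eqP.
have [l klI] := IF k kF.
exists (repr (rho (a * 'X_[m]))); last by rewrite reprK.
have lw : 'X_l * repr (rho (a * 'X_[m])) \in I.
  apply/pi_eq0; rewrite pi_mulr reprK -rhoZ; apply: rho0.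
  (* One factor of z_l^q and one factor z_k of z^m form the monomial z_k z_l of I. *)
  have -> : 'X_l ^+ (p ^ e) * (a * 'X_[m]) =
      'X_l ^+ (p ^ e).-1 * a * 'X_[m - U_(k)] * ('X_k * 'X_l).
    have mE : (m - U_(k) + U_(k))%MM = m by rewrite submK // lep1mP.
    rewrite -{1}(prednK q_gt0) exprSr -[in LHS]mE mpolyXD -!mulrA; congr (_ * _).
    by rewrite mulrCA; congr (_ * _); rewrite mulrC -mulrA.
  exact: idealMr.
have := no_linear_terms_coeff (IL _ lw) (_ : mdeg (U_(l) + 0) < 2)%N.
by rewrite mulrC mcoeffMX; apply; rewrite addm0 mdeg1.
Qed.

(** It suffices to treat z^mb z^m with z^m leading in some f of I. The trace of in(g) z^mb z^m is 0
    or a multiple of a monomial z^mu, and z^mu leads Tr(g z^mb f) once f is scaled to be monic. *)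
Lemma trace_initial_ideal e psi g mg : frobenius_splitting (p ^ e) psi ->
    lex_monic g mg -> (forall j, j \in I -> trace p e psi (g * j) \in I) ->
  forall j, j \in initial_ideal I ->
    trace p e psi ('X_[mg] * j) \in initial_ideal I.
Proof.
move=> psiP gm gI j jI; rewrite -[j]mul1r; move: 1; move/mem_generated_ideal: jI.
move: j; apply: ideal_gen_min => [|_ [f [m [fI fm ->]]] b].
  split=> [b|u v Hu Hv b|a u Hu b]; last by rewrite [b * _]mulrA.
    by rewrite !mulr0 (trace0 N chK psiP) rpred0.
  by rewrite !mulrDr (traceD chK psiP) rpredD ?Hu ?Hv.
elim/mpolyind: b => [|c mb b _ _ IH]; first by rewrite mul0r mulr0 (trace0 N chK psiP) rpred0.
rewrite mulrDl mulrDr (traceD chK psiP) rpredD // -scalerAl -scalerAr -!mpolyXD.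
case: (pselect (exists mu, trace_mnm p e mu = mg + (mb + m))%MM) => [[mu Emu]|nmu].
  have -> : trace p e psi (c *: 'X_[mg + (mb + m)]) = (psi c)%:MP * 'X_[mu].
    apply/mpolyP => nu; rewrite mcoeff_trace // mcoeffZ mcoeffCM !mcoeffX -Emu.
    case: (altP (mu =P nu)) => [->|ne]; first by rewrite eqxx !mulr1.
    rewrite (inj_eq (trace_mnm_inj chK (e := e))) (negPf ne) !mulr0.
    by case: psiP => _ psiZ _; have := psiZ 0 0; rewrite mulr0 mul0r.
  apply: idealMr; apply: (mem_initial_ideal (f := trace p e psi (g * ('X_[mb] * ((f@_m)^-1 *: f))))).
    by apply: gI; rewrite -mul_mpolyC mulrA; apply: idealMr.
  apply: (lex_lead_trace chK psiP). rewrite Emu.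
  apply: lex_monicM gm _; apply: lex_monicM (lex_lead_monic fm); exact: lex_monicX.
have -> : trace p e psi (c *: 'X_[mg + (mb + m)]) = 0; last exact: rpred0.
apply/mpolyP => nu; rewrite mcoeff_trace // mcoeffZ mcoeffX mcoeff0.
case: eqP => [E|_]; first by case: nmu; exists nu.
by rewrite mulr0; case: psiP => _ psiZ _; have := psiZ 0 0; rewrite mulr0 mul0r.
Qed.

End InitialIdeal.

Lemma leq_sum_eq (I : finType) (P : pred I) (E1 E2 : I -> nat) :
    (forall i, P i -> (E1 i <= E2 i)%N) ->
    (\sum_(i | P i) E1 i = \sum_(i | P i) E2 i)%N ->
  forall i, P i -> E1 i = E2 i.
Proof.
move=> le eq i Pi; have [_] := leqif_sum (fun i Pi => leqif_eq (le i Pi)).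
by rewrite eq eqxx => /esym/forall_inP/(_ i Pi)/eqP.
Qed.

(** * The ideal of a clique as the kernel of a toric map *)

Section EdgeBinomials.
Variables (K : fieldType) (n : nat).
Local Notation S := {mpoly K[n + n]}.
Local Notation x := (@xvar K n).
Local Notation y := (@yvar K n).
Local Notation f := (@edge_binomial K n).

Lemma edge_binomialC i j : f j i = - f i j.
Proof. by rewrite /edge_binomial opprB. Qed.

Lemma edge_binomialii i : f i i = 0.
Proof. by rewrite /edge_binomial subrr. Qed.

(** The expansion of the zero determinant with rows x, x, y on the columns i, j, k. *)
Lemma edge_binomial3 i j k : x j * f i k = x i * f j k + x k * f i j.
Proof. by rewrite /edge_binomial; ring. Qed.

Section ToricKernel.
Variables (A : {set 'I_n}) (I : idealr S).
Hypothesis AI : forall i j, i \in A -> j \in A -> f i j \in I.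

(** The columns (x_i, y_i) with i in A become x_i (1, T), a matrix of rank one; the other variables
    are fixed, and the target is a domain. *)
Definition toric_var (k : 'I_(n + n)) : {poly S} :=
  match split k with
  | inl i => (x i)%:P
  | inr i => if i \in A then (x i)%:P * 'X else (y i)%:P
  end.

Definition toric : S -> {poly S} := mmap (polyC \o @mpolyC _ K) toric_var.
HB.instance Definition _ := GRing.RMorphism.on toric.

Lemma toricX k : toric 'X_k = toric_var k.
Proof. by rewrite /toric mmapX mmap1U. Qed.

Lemma toricx i : toric (x i) = (x i)%:P.
Proof. by rewrite toricX /toric_var (unsplitK (inl i)). Qed.

Lemma toricy i : i \in A -> toric (y i) = (x i)%:P * 'X.
Proof. by move=> iA; rewrite toricX /toric_var (unsplitK (inr i)) iA. Qed.

Lemma toric_edge i j : i \in A -> j \in A -> toric (f i j) = 0.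
Proof.
move=> iA jA; rewrite /edge_binomial rmorphB !rmorphM /= !toricx !toricy //.
by rewrite mulrCA subrr.
Qed.

Definition toric_mnm (m : 'X_{1..n + n}) : 'X_{1..n + n} :=
  [multinom match split k with
            | inl i => m (lshift n i) + (i \in A) * m (rshift n i)
            | inr i => (i \notin A) * m (rshift n i)
            end%N | k < n + n].

Definition toric_deg (m : 'X_{1..n + n}) := (\sum_(i in A) m (rshift n i))%N.

(** By [mmap1_toric], two monomials have the same image under [toric] exactly in this case. *)
Definition toric_eq m m' :=
  (toric_mnm m == toric_mnm m') && (toric_deg m == toric_deg m').

Lemma toric_mnm_l m i :
  toric_mnm m (lshift n i) = (m (lshift n i) + (i \in A) * m (rshift n i))%N.
Proof. by rewrite mnmE (unsplitK (inl i)). Qed.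

Lemma toric_mnm_r m i : toric_mnm m (rshift n i) = ((i \notin A) * m (rshift n i))%N.
Proof. by rewrite mnmE (unsplitK (inr i)). Qed.

Lemma mmap1_toric m :
  mmap1 toric_var m = ('X_[toric_mnm m])%:P * 'X^(toric_deg m).
Proof.
rewrite /mmap1 mpolyXE_id !big_split_ord /= rmorphM /= !rmorph_prod /=.
rewrite /toric_deg -prodrXr [X in _ = _ * X]big_mkcond -!big_split /=.
apply: eq_bigr => i _.
rewrite toric_mnm_l toric_mnm_r /toric_var (unsplitK (inl i)) (unsplitK (inr i)).
case: (i \in A); rewrite /= mul1n mul0n; last by rewrite addn0 mulr1 !rmorphXn.
by rewrite expr0 mulr1 exprD rmorphM !rmorphXn exprMn mulrA.
Qed.

Lemma coef_toric w (d : nat) c :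
  (toric w)`_d@_c = \sum_(m <- msupp w | (toric_mnm m == c) && (toric_deg m == d)) w@_m.
Proof.
rewrite /toric /mmap coef_sum raddf_sum [RHS]big_mkcond /=; apply: eq_bigr => m _.
rewrite mmap1_toric !coefCM coefXn mcoeffCM.
case: (eqVneq (toric_deg m) d) => _.
  by rewrite mulr1 mcoeffX andbT; case: eqP; rewrite ?mulr1 ?mulr0.
by rewrite mulr0 mcoeff0 mulr0 andbF.
Qed.

(** A factor x_i y_j is replaced by x_j y_i. The new exponents are described by sums on both sides,
    which avoids truncated subtraction. *)
Lemma toric_swap (m : 'X_{1..n + n}) i j :
    i \in A -> j \in A -> m (lshift n i) != 0%N -> m (rshift n j) != 0%N ->
  exists m1, [/\ 'X_[m] - 'X_[m1] \in I, toric_eq m1 m,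
    (forall l, m1 (lshift n l) + (i == l) = m (lshift n l) + (j == l))%N &
    (forall l, m1 (rshift n l) + (j == l) = m (rshift n l) + (i == l))%N].
Proof.
move=> iA jA mi mj; pose m0 := (m - (U_(lshift n i) + U_(rshift n j)))%MM.
have m0E : (m0 + (U_(lshift n i) + U_(rshift n j)))%MM = m.
  apply/mnmP => k; rewrite !(mnmBE, mnmDE, mnm1E) subnK //.
  case: (eqVneq (lshift n i) k) => [<-|_]; last by case: eqP => [<-|//]; rewrite lt0n.
  by rewrite eq_rlshift addn0 lt0n.
pose m1 := (m0 + (U_(lshift n j) + U_(rshift n i)))%MM.
have m1l l : (m1 (lshift n l) + (i == l) = m (lshift n l) + (j == l))%N.
  by rewrite -m0E !(mnmDE, mnm1E) !eq_lshift !eq_rlshift /= !addn0 addnAC.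
have m1r l : (m1 (rshift n l) + (j == l) = m (rshift n l) + (i == l))%N.
  by rewrite -m0E !(mnmDE, mnm1E) !eq_rshift !eq_lrshift /= !add0n addnAC.
exists m1; split=> //.
  have -> : 'X_[m] - 'X_[m1] = 'X_[m0] * f i j.
    by rewrite -{1}m0E /m1 2!mpolyXD (mpolyXD _ m0) mpolyXD mulrBr.
  exact/idealMr/AI.
apply/andP; split; apply/eqP.
  have nA l : l \notin A -> (i == l = false) * (j == l = false).
    by move=> lA; split; apply: contraNF lA => /eqP<-.
  apply/mnmP => k; rewrite -[k]splitK; case: (split k) => l /=.
    rewrite !toric_mnm_l; move: (m1l l) (m1r l).
    case: (boolP (l \in A)) => [_|/nA[-> ->]]; rewrite ?mul1n ?mul0n ?addn0 //.
    by clear; move: (nat_of_bool _) (nat_of_bool _) => u v; lia.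
  rewrite !toric_mnm_r; move: (m1r l).
  by case: (boolP (l \in A)) => [//|/nA[-> ->]]; rewrite !addn0 => ->.
have s1 k : k \in A -> (\sum_(l in A) (k == l) = 1)%N.
  by move=> kA; rewrite (bigD1 k) //= eqxx big1 // => l /andP[_ /negPf]; rewrite eq_sym => ->.
have : (\sum_(l in A) (m1 (rshift n l) + (j == l)) =
        \sum_(l in A) (m (rshift n l) + (i == l)))%N by apply: eq_bigr => l _.
by rewrite !big_split /= !s1 // => /addIn.
Qed.

Lemma toric_eqA m m' l : toric_eq m m' -> l \in A ->
  (m (lshift n l) + m (rshift n l) = m' (lshift n l) + m' (rshift n l))%N.
Proof.
move=> /andP[/eqP em _] lA; have /mnmP/(_ (lshift n l)) := em.
by rewrite !toric_mnm_l lA !mul1n.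
Qed.

Lemma toric_eq_r m m' : toric_eq m m' ->
  (forall l, l \in A -> m (rshift n l) = m' (rshift n l)) -> m = m'.
Proof.
move=> E H; apply/mnmP => k; rewrite -[k]splitK; case: (split k) => l /=.
  have := toric_eqA E (l := l); move: E => /andP[/eqP/mnmP/(_ (lshift n l)) + _].
  rewrite !toric_mnm_l; case: (boolP (l \in A)) => lA; last by rewrite !addn0.
  by move=> _ /(_ isT); rewrite H // => /addIn.
case: (boolP (l \in A)) => [/H //|lA]; case/andP: E => /eqP/mnmP/(_ (rshift n l)) + _.
by rewrite !toric_mnm_r lA !mul1n.
Qed.

Lemma toric_eq_leq m m' : toric_eq m m' ->
  (forall l, l \in A -> (m (rshift n l) <= m' (rshift n l))%N) -> m = m'.
Proof.
move=> E H; apply: (toric_eq_r E) => l lA.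
by case/andP: E => _ /eqP sumE; apply: (leq_sum_eq H sumE lA).
Qed.

Lemma toric_eq_sym m m' : toric_eq m m' = toric_eq m' m.
Proof. by rewrite /toric_eq eq_sym [toric_deg _ == _]eq_sym. Qed.

(** Induction on the total excess of the x-exponents of m over those of m'. If x_i is in excess,
    some x_j is in deficit, and swapping x_i y_j for x_j y_i lowers the excess. *)
Lemma toric_eq_mod m m' : toric_eq m m' -> 'X_[m] - 'X_[m'] \in I.
Proof.
move: {2}(\sum_l (m (lshift n l) - m' (lshift n l)))%N
  (leqnn (\sum_l (m (lshift n l) - m' (lshift n l)))) => k.
have small m2 m3 : toric_eq m2 m3 ->
    (forall l, l \in A -> (m2 (lshift n l) <= m3 (lshift n l))%N) -> m2 = m3.
  move=> E H; apply/esym/toric_eq_leq; first by rewrite toric_eq_sym.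
  by move=> l lA; have := toric_eqA E lA; have := H l lA; clear; lia.
elim: k m => [|k IH] m le E.
  rewrite (small m m') ?subrr ?rpred0 // => l lA; move: le; rewrite leqn0.
  by rewrite sum_nat_eq0 => /forallP/(_ l); rewrite subn_eq0.
case: (boolP [forall l in A, m (lshift n l) <= m' (lshift n l)]%N).
  by move=> /forall_inP/(small _ _ E)->; rewrite subrr rpred0.
rewrite negb_forall_in => /exists_inP[i iA]; rewrite -ltnNge => lti.
have [j jA ltj] : exists2 j, j \in A & (m (lshift n j) < m' (lshift n j))%N.
  apply/exists_inP; apply: contraLR lti; rewrite negb_exists_in => /forall_inP H.
  rewrite (small m' m) ?ltnn // 1?toric_eq_sym // => l lA.
  by rewrite leqNgt H.
have ij : (i == j) = false by apply: contraTF ltj => /eqP<-; rewrite -leqNgt ltnW.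
(* The exponents of x_j and y_j have the same sum in m and m', so a deficit of x_j leaves a y_j to
   swap. *)
have mj : m (rshift n j) != 0%N by have := toric_eqA E jA; move: ltj; clear; lia.
have mi : m (lshift n i) != 0%N by move: lti; clear; lia.
have [m1 [m1I m1m m1l _]] := toric_swap iA jA mi mj.
rewrite -[_ - _](subrKA 'X_[m1]) rpredD //; apply: IH; last first.
  by move: E m1m; rewrite /toric_eq => /andP[/eqP<- /eqP<-].
rewrite -ltnS; apply: leq_trans le.
rewrite [X in (X < _)%N](bigD1 i) // [X in (_ < X)%N](bigD1 i) //= -addSn.
apply: leq_add.
  have := m1l i; rewrite eqxx eq_sym ij; move: lti; clear; lia.
apply: leq_sum => l il; have := m1l l; rewrite eq_sym (negPf il).
by case: eqP ltj => [<-|_]; clear; lia.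
Qed.

(** Modulo I every monomial equals a chosen representative of its fibre under [toric], and the
    coefficients of w over a fibre add up to a coefficient of [toric w], hence to 0. *)
Lemma toric_kernel w : toric w = 0 -> w \in I.
Proof.
move=> w0; pose nf m := choose (toric_eq m) m.
have nfE m : toric_eq m (nf m) by apply: chooseP; rewrite /toric_eq !eqxx.
have toric_eq_nf m m' : toric_eq m m' -> nf m = nf m'.
  move=> E; have /andP[/eqP e1 /eqP e2] := E.
  have same : toric_eq m =1 toric_eq m' by move=> c; rewrite /toric_eq e1 e2.
  rewrite /nf (eq_choose same); apply: choose_id; rewrite -?same //.
  by rewrite /toric_eq !eqxx.
suff -> : w = \sum_(m <- msupp w) w@_m *: ('X_[m] - 'X_[nf m]).
  by apply: rpred_sum => m _; rewrite -mul_mpolyC; apply/idealMr/toric_eq_mod.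
under eq_bigr do rewrite scalerBr; rewrite sumrB -mpolyE.
suff -> : \sum_(m <- msupp w) w@_m *: 'X_[nf m] = 0 :> S by rewrite subr0.
apply/mpolyP => mu; rewrite mcoeff0 raddf_sum /=.
have -> : \sum_(m <- msupp w) (w@_m *: 'X_[nf m] : S)@_mu =
  \sum_(m <- msupp w | nf m == mu) w@_m.
  rewrite [RHS]big_mkcond; apply: eq_bigr => m _; rewrite mcoeffZ mcoeffX.
  by case: eqP; rewrite ?mulr1 ?mulr0.
case: (eqVneq (nf mu) mu) => [nfmu|nfmu].
  transitivity ((toric w)`_(toric_deg mu)@_(toric_mnm mu));
    last by rewrite w0 coef0 mcoeff0.
  rewrite coef_toric; apply: eq_bigl => m; apply/eqP/idP => [E|E]; last by rewrite (toric_eq_nf _ _ E).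
  by have := nfE m; rewrite E.
rewrite big1 // => m /eqP E; move: nfmu; rewrite -(toric_eq_nf m mu) ?E ?eqxx //.
by have := nfE m; rewrite E.
Qed.

End ToricKernel.
End EdgeBinomials.

(** * Combinatorics of closed labellings *)

Section Neighbours.
Variables (n : nat) (G : rel 'I_n).

Definition has_upper : {set 'I_n} := [set i : 'I_n | [exists j : 'I_n, (i < j)%N && G i j]].
Definition has_lower : {set 'I_n} := [set j : 'I_n | [exists i : 'I_n, (i < j)%N && G i j]].

Definition next (i : 'I_n) : 'I_n :=
  odflt i [pick j : 'I_n | [&& (i < j)%N, G i j &
    [forall k : 'I_n, (i < k)%N && G i k ==> (j <= k)%N]]].

Lemma has_upperI (i j : 'I_n) : (i < j)%N -> G i j -> i \in has_upper.
Proof. by move=> ij Gij; rewrite inE; apply/existsP; exists j; rewrite ij. Qed.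

Lemma has_lowerI (i j : 'I_n) : (i < j)%N -> G i j -> j \in has_lower.
Proof. by move=> ij Gij; rewrite inE; apply/existsP; exists i; rewrite ij. Qed.

Lemma nextP i : i \in has_upper -> [/\ (i < next i)%N, G i (next i) &
  forall k : 'I_n, (i < k)%N -> G i k -> (next i <= k)%N].
Proof.
rewrite inE => /existsP[j0 Pj0]; rewrite /next; case: pickP => [j|none].
  case/and3P=> ij Gij /forallP H; split=> // k ik Gik.
  by have := H k; rewrite ik Gik.
case: (arg_minnP (P := fun j : 'I_n => (i < j)%N && G i j) val Pj0) => j /andP[ij Gij] jmin.
have /negP[] := none j; rewrite ij Gij; apply/forallP => k; apply/implyP => /jmin.
by [].
Qed.

Hypothesis G_sym : ssrbool.symmetric G.
Hypothesis G_closed : closed_labelling G.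

(** If next i = next j with i < j, closedness makes i, j an edge, so next i <= j < next j. *)
Lemma next_inj : {in has_upper &, injective next}.
Proof.
move=> i j iU jU E; have [ii Gi mini] := nextP iU; have [jj Gj minj] := nextP jU.
case: (ltngtP i j) => [ij|ji|/val_inj //].
- have ne : (i, next i) <> (j, next j) by case=> ? _; subst j; rewrite ltnn in ij.
  have [_ Gij] := G_closed ii jj Gi Gj ne.
  by have := mini _ ij (Gij E); rewrite E leqNgt jj.
- have ne : (j, next j) <> (i, next i) by case=> ? _; subst j; rewrite ltnn in ji.
  have [_ Gji] := G_closed jj ii Gj Gi ne.
  by have := minj _ ji (Gji (esym E)); rewrite -E leqNgt ii.
Qed.

(** The largest smaller neighbour i of j has next i = j: were next i < j, closedness at i would make
    next i a neighbour of j, larger than i. *)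
Lemma next_image : next @: has_upper = has_lower.
Proof.
apply/setP => j; apply/imsetP/idP => [[i /nextP[ii Gi _] ->]|].
  exact: has_lowerI Gi.
rewrite inE => /existsP[i0 Pi0].
case: (arg_maxnP (P := fun i : 'I_n => (i < j)%N && G i j) val Pi0) => i /andP[ij Gij] imax.
exists i; first exact: has_upperI Gij.
have [ii Gi mini] := nextP (has_upperI ij Gij).
apply/val_inj/eqP; rewrite eqn_leq (mini _ ij Gij) andbT leqNgt; apply/negP => lt.
have ne : (i, next i) <> (i, j) by case=> E; rewrite E ltnn in lt.
have [/(_ erefl) GE _] := G_closed ii ij Gi Gij ne.
have /imax : (next i < j)%N && G (next i) j by rewrite lt.
by rewrite /= leqNgt ii.
Qed.

Lemma card_has_lower : #|has_lower| = #|has_upper|.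
Proof. by rewrite -next_image card_in_imset //; exact: next_inj. Qed.

Definition lower_clique (l : 'I_n) : {set 'I_n} :=
  [set a : 'I_n | (a == l) || (a < l)%N && G a l].

Lemma lower_cliqueP l a b : a \in lower_clique l -> b \in lower_clique l ->
  a != b -> G a b.
Proof.
rewrite !inE => /orP[/eqP->|/andP[al Gal]] /orP[/eqP->|/andP[bl Gbl]]; rewrite ?eqxx //.
  by rewrite G_sym.
move=> ab; have ne : (a, l) <> (b, l) by case=> E; rewrite E eqxx in ab.
by have [_] := G_closed al bl Gal Gbl ne; apply.
Qed.

(** Here next a <= l, and if they differ, closedness at the common lower end a joins them. *)
Lemma next_lower_clique l a : a \in lower_clique l -> a != l ->
  [/\ a \in has_upper, (a < next a)%N & next a \in lower_clique l].
Proof.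
rewrite !inE => /orP[->//|/andP[al Gal] _].
have aU := has_upperI al Gal; have [aa Ga amin] := nextP aU.
split=> //; first by move: aU; rewrite inE.
case: (eqVneq (next a) l) => //= nl; have := amin _ al Gal.
rewrite leq_eqVlt => /orP[/eqP/val_inj E|lt]; first by rewrite E eqxx in nl.
have ne : (a, next a) <> (a, l) by case=> E; rewrite E eqxx in nl.
by rewrite lt; have [H _] := G_closed aa al Ga Gal ne; apply: H.
Qed.

End Neighbours.

(** * The splitting polynomial for the binomial edge ideal and its initial ideal *)

Section EdgeIdeal.
Variables (K : fieldType) (n : nat) (G : rel 'I_n).
Hypothesis G_sym : ssrbool.symmetric G.
Local Notation S := {mpoly K[n + n]}.
Local Notation x := (@xvar K n).
Local Notation y := (@yvar K n).
Local Notation f := (@edge_binomial K n).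
Local Notation J := (binomial_edge_ideal K G).
Local Notation U := (has_upper G).
Local Notation V := (has_lower G).

Lemma edge_binomial_ideal (i j : 'I_n) : G i j -> f i j \in J.
Proof.
move=> Gij; case: (ltngtP i j) => [ij|ji|/val_inj->].
- by apply/mem_generated_ideal/mem_ideal_gen; exists i, j.
- rewrite edge_binomialC rpredN; apply/mem_generated_ideal/mem_ideal_gen.
  by exists j, i; rewrite G_sym.
- by rewrite edge_binomialii rpred0.
Qed.

Lemma edge_ideal_no_linear_terms a : a \in J -> no_linear_terms a.
Proof.
move=> /mem_generated_ideal; apply: ideal_gen_min; first exact: no_linear_terms_like.
move=> _ [i [j [_ _ ->]]] m; rewrite /edge_binomial /xvar /yvar -!mpolyXD.
by move=> /msuppB_le; rewrite mem_cat !msuppX !inE => /orP[] /eqP->; rewrite mdegD !mdeg1.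
Qed.

Lemma lex_monic_edge (i j : 'I_n) : (i < j)%N ->
  lex_monic (f i j) (U_(lshift n i) + U_(rshift n j))%MM.
Proof.
move=> ij; exists (- (x j * y i)); first by rewrite /edge_binomial /xvar /yvar mpolyXD.
move=> m; rewrite (perm_mem (msuppN _)) /xvar /yvar -mpolyXD msuppX inE => /eqP->.
exists (lshift n i); rewrite !(mnmDE, mnm1E) !eq_shift eqxx.
have -> : (j == i) = false by apply: gtn_eqF.
split=> // k; rewrite -[k]splitK; case: (split k) => l /=; last by move=> H; have := ltn_trans H (ltn_ord i); rewrite ltnNge leq_addr.
move=> li; rewrite !(mnmDE, mnm1E) !eq_shift.
by rewrite -!val_eqE /= gtn_eqF ?(ltn_trans li) // gtn_eqF.
Qed.

Variables (p : nat) (chK : p \in [pchar K]).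

Definition chain_product (k : nat) : S := \prod_(b in U) f b (next G b) ^+ k.

Definition chain_mnm (k : nat) : 'X_{1..n + n} :=
  (\sum_(b in U) (U_(lshift n b) + U_(rshift n (next G b))) *+ k)%MM.

Definition free_mnm (k : nat) : 'X_{1..n + n} :=
  (\sum_(i in ~: U) U_(lshift n i) *+ k + \sum_(j in ~: V) U_(rshift n j) *+ k)%MM.

Lemma lex_monic_chain k : lex_monic (chain_product k) (chain_mnm k).
Proof.
apply: lex_monic_prod => b /nextP[bb _ _]; apply: lex_monicXn; exact: lex_monic_edge.
Qed.

Lemma mdeg_free_mnm k : mdeg (free_mnm k) = ((#|~: U| + #|~: V|) * k)%N.
Proof.
rewrite mdegD !mdeg_sum (eq_bigr (fun=> k)) => [|i _]; last by rewrite mdegMn mdeg1 mul1n.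
rewrite [X in (_ + X)%N](eq_bigr (fun=> k)) => [|i _]; last by rewrite mdegMn mdeg1 mul1n.
by rewrite !sum_nat_const -mulnDl.
Qed.

Lemma sum_mem_eq (A : {set 'I_n}) (k : nat) i :
  (\sum_(b in A) (b == i) * k = (i \in A) * k)%N.
Proof.
case: (boolP (i \in A)) => iA.
  rewrite (bigD1 i) //= eqxx big1 ?addn0 // => b /andP[_ /negPf->] //.
by rewrite big1 // => b bA; case: eqP => // E; rewrite -E bA in iA.
Qed.

Hypothesis G_closed : closed_labelling G.

(** The leading monomials use the x_b with b in U and, as [next] is a bijection from U to V, the y_j
    with j in V; the free variables supply the rest. *)
Lemma chain_free_mnm e : (chain_mnm (p ^ e - 1) + free_mnm (p ^ e - 1))%MM =
  top_mnm (n + n) p e.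
Proof.
apply/mnmP => k; rewrite [RHS]mnmE -subn1; move: (p ^ e - 1)%N => q.
rewrite !mnmDE /chain_mnm !mnm_sumE -[k]splitK; case: (split k) => i /=.
  under eq_bigr do rewrite mulmnE mnmDE !mnm1E !eq_shift addn0.
  under [X in (_ + (X + _))%N]eq_bigr do rewrite mulmnE mnm1E eq_shift.
  under [X in (_ + (_ + X))%N]eq_bigr do rewrite mulmnE mnm1E eq_shift mul0n.
  rewrite !sum_mem_eq big1_eq addn0 finset.in_setC -mulnDl.
  by case: (i \in U); rewrite mul1n.
under eq_bigr do rewrite mulmnE mnmDE !mnm1E !eq_shift add0n.
under [X in (_ + (X + _))%N]eq_bigr do rewrite mulmnE mnm1E eq_shift mul0n.
under [X in (_ + (_ + X))%N]eq_bigr do rewrite mulmnE mnm1E eq_shift.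
rewrite -(big_imset (fun j => (j == i) * q)%N) /=; last exact: next_inj.
rewrite next_image // !sum_mem_eq big1_eq add0n finset.in_setC -mulnDl.
by case: (i \in V); rewrite mul1n.
Qed.

Local Notation X := (\prod_(i < n) x i).

Lemma xvar_dvd_prod (i : 'I_n) : X = x i * \prod_(j < n | j != i) x j.
Proof. by rewrite (bigD1 i). Qed.

(** For an edge a < l, Tr(g b f_al) is shown to vanish under [toric] for the clique A of l; that
    kernel lies in J because f_ij does for all i, j in A. *)
Lemma trace_chain_ideal e psi : frobenius_splitting (p ^ e) psi ->
  forall j, j \in J -> trace p e psi (chain_product (p ^ e - 1) * j) \in J.
Proof.
move=> psiP j /mem_generated_ideal jJ; rewrite -[j]mul1r; move: {jJ} j jJ 1.
have tr0 : trace p e psi (0 : S) = 0 by exact: trace0.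
apply: ideal_gen_min => [|_ [a [l [al Gal ->]]] b].
  split=> [b|u v Hu Hv b|a u Hu b]; last by rewrite [b * _]mulrA.
    by rewrite !mulr0 tr0 rpred0.
  by rewrite !mulrDr (traceD chK psiP) rpredD ?Hu ?Hv.
pose A := lower_clique G l; pose g := chain_product (p ^ e - 1).
apply: (@toric_kernel _ _ A) => [i k iA kA|].
  case: (eqVneq i k) => [->|ik]; first by rewrite edge_binomialii rpred0.
  exact: edge_binomial_ideal (lower_cliqueP G_sym G_closed iA kA ik).
pose Q (h : S) := forall c, toric A (trace p e psi (g * (c * h))) = 0.
have [Q0 QD QM] : ideal_like Q.
  split=> [c|u v Hu Hv c|d u Hu c]; last by rewrite [c * _]mulrA.
    by rewrite !mulr0 tr0 rmorph0.
  by rewrite !mulrDr (traceD chK psiP) rmorphD /= Hu Hv addr0.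
(* The factor f_(d,next d)^(q-1) of g and the additional f_(d,next d) form a q-th power, which
   leaves the trace as a factor killed by [toric]. *)
have Qchain d : d \in A -> d != l -> Q (f d (next G d)).
  move=> dA dl c; have [dU _ ndA] := next_lower_clique G_closed dA dl.
  rewrite /g /chain_product (bigD1 d) //=.
  set r := \prod_(b0 in _ | _) _.
  have -> : f d (next G d) ^+ (p ^ e - 1) * r * (c * f d (next G d)) =
            f d (next G d) ^+ (p ^ e) * (r * c).
    have -> : (p ^ e = (p ^ e - 1).+1)%N.
      by rewrite subn1 prednK // expn_gt0 prime_gt0 ?(pcharf_prime chK).
    by rewrite subn1 /= exprS; ring.
  by rewrite (trace_expM chK psiP) rmorphM /= toric_edge // mul0r.
(* Following [next] from a to l, [edge_binomial3] reduces x_(next a) f_al to f_(next a,l) and a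
   binomial covered by [Qchain]; the other factors of X only multiply the relation. *)
have [k Qk] : exists k, Q (X ^+ k * f a l).
  have aA : a \in A by rewrite inE al Gal orbT.
  move: {2}(l - a)%N (leqnn (l - a)) => d; elim: d a aA {al Gal} => [|d IH] a aA.
    rewrite leqn0 subn_eq0 => la; exists 0%N; suff -> : a = l by rewrite edge_binomialii mulr0.
    move: aA; rewrite inE => /orP[/eqP //|/andP[]]; by rewrite ltnNge la.
  case: (eqVneq a l) => [->|al le]; first by exists 0%N; rewrite edge_binomialii mulr0.
  have [aU aa naA] := next_lower_clique G_closed aA al.
  have [|k Qk] := IH _ naA; first by move: le aa; clear; lia.
  exists k.+1; pose X' := \prod_(j < n | j != next G a) x j.
  have -> : X ^+ k.+1 * f a l = X' * x a * (X ^+ k * f (next G a) l) +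
      X' * X ^+ k * x l * f a (next G a).
    have E : x (next G a) * X' = X by rewrite /X' -xvar_dvd_prod.
    rewrite exprSr -[in X in _ * X * _]E; have := edge_binomial3 K a (next G a) l.
    move: (X ^+ k) => Z H.
    rewrite (_ : _ * f a l = Z * X' * (x (next G a) * f a l)); last by ring.
    by rewrite H; ring.
  exact: (QD _ _ (QM _ _ Qk) (QM _ _ (Qchain a aA al))).
have : toric A (X ^+ k * trace p e psi (g * (b * f a l))) = 0.
  (* X^k enters the trace as X^(k q); one factor X^k is spent on [Qk] and the rest is absorbed in
     the multiplier. *)
  rewrite -(trace_expM chK psiP).
  have -> : (X ^+ k) ^+ (p ^ e) * (g * (b * f a l)) =
    g * ((X ^+ k) ^+ (p ^ e - 1) * b * (X ^+ k * f a l)).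
    have qE : (p ^ e = (p ^ e - 1).+1)%N.
      by rewrite subn1 prednK // expn_gt0 prime_gt0 ?(pcharf_prime chK).
    by rewrite {1}qE exprS; ring.
  exact: Qk.
(* The image of X in the domain is nonzero, so X^k cancels. *)
rewrite rmorphM rmorphXn rmorph_prod /= => /eqP; rewrite mulf_eq0 => /orP[|/eqP //].
rewrite expf_eq0 => /andP[_]; rewrite prodf_seq_eq0 => /hasP[i _ /=].
rewrite toricx polyC_eq0 /xvar => /eqP/(congr1 (mcoeff U_(lshift n i)%MM)).
by rewrite mcoeffX eqxx mcoeff0 => /eqP; rewrite oner_eq0.
Qed.

(** The common value t of both thresholds. *)
Definition edge_fpt := (#|~: U| + #|~: V|)%N.

Lemma trace_chain_free e (psi : K -> K) : frobenius_splitting (p ^ e) psi ->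
  forall h : S, lex_monic h (chain_mnm (p ^ e - 1)) ->
  trace p e psi (h * 'X_[free_mnm (p ^ e - 1)]) = 1.
Proof.
move=> psiP h hm; apply: (trace_top chK psiP); rewrite -chain_free_mnm.
by apply: lex_monicM hm _; apply: lex_monicX.
Qed.

Lemma edge_ideal_splitting e (psi : K -> K) : frobenius_splitting (p ^ e) psi ->
  exists (g : S) (m : 'X_{1..n + n}), [/\ (forall j, j \in J -> trace p e psi (g * j) \in J),
    trace p e psi (g * 'X_[m]) = 1 & mdeg m = (edge_fpt * (p ^ e - 1))%N].
Proof.
move=> psiP; exists (chain_product (p ^ e - 1)), (free_mnm (p ^ e - 1)).
rewrite mdeg_free_mnm; split=> //; first exact: trace_chain_ideal.
apply: trace_chain_free => //; exact: lex_monic_chain.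
Qed.

Lemma initial_ideal_splitting e (psi : K -> K) : frobenius_splitting (p ^ e) psi ->
  exists (g : S) (m : 'X_{1..n + n}), [/\ (forall j, j \in initial_ideal J ->
                     trace p e psi (g * j) \in initial_ideal J),
    trace p e psi (g * 'X_[m]) = 1 & mdeg m = (edge_fpt * (p ^ e - 1))%N].
Proof.
move=> psiP; exists 'X_[chain_mnm (p ^ e - 1)], (free_mnm (p ^ e - 1)).
rewrite mdeg_free_mnm; split=> //.
  apply: (trace_initial_ideal chK psiP (lex_monic_chain _)); exact: trace_chain_ideal.
apply: trace_chain_free => //; exact: lex_monicX.
Qed.

End EdgeIdeal.

(** * Degree bounds for both quotients *)

Section UpperBound.
Variables (K : fieldType) (n : nat) (G : rel 'I_n).
Hypothesis G_sym : ssrbool.symmetric G.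
Hypothesis G_closed : closed_labelling G.
Local Notation S := {mpoly K[n + n]}.
Local Notation x := (@xvar K n).
Local Notation y := (@yvar K n).
Local Notation f := (@edge_binomial K n).
Local Notation J := (binomial_edge_ideal K G).
Local Notation U := (has_upper G).
Local Notation V := (has_lower G).
Local Notation X := (\prod_(i < n) x i).
Variables (p : nat) (chK : p \in [pchar K]).

Let q_gt0 e : (0 < p ^ e)%N.
Proof. by rewrite expn_gt0 prime_gt0 ?(pcharf_prime chK). Qed.

Lemma initial_ideal_degree_bound e :
  cartier_degree_bound p (initial_ideal J) e (edge_fpt G * (p ^ e - 1)).
Proof.
pose F := (@lshift n n @: ~: U) :|: (@rshift n n @: ~: V).
have cF : (#|F| <= edge_fpt G)%N.
  by rewrite (leq_trans (leq_card_setU _ _)) // leq_add ?leq_imset_card.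
have inI (i j : 'I_n) : (i < j)%N -> G i j -> x i * y j \in initial_ideal J.
  move=> ij Gij; rewrite /xvar /yvar -mpolyXD.
  apply: mem_initial_ideal (edge_binomial_ideal K G_sym Gij) _.
  exact/lex_monic_lead/lex_monic_edge.
move=> rho rhoP m a dm.
apply: (cartier_degree_bound_quadratic chK (F := F) _ _ rhoP).
- by apply: initial_no_linear_terms; apply: edge_ideal_no_linear_terms.
- move=> k; rewrite -[k]splitK; case: (split k) => i /=.
    rewrite finset.in_setU negb_or => /andP[+ _].
    rewrite mem_imset ?finset.in_setC ?negbK; last exact: lshift_inj.
    rewrite inE => /existsP[j /andP[ij Gij]]; exists (rshift n j); exact: inI.
  rewrite finset.in_setU negb_or => /andP[_ +].
  rewrite mem_imset ?finset.in_setC ?negbK; last exact: rshift_inj.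
  rewrite inE => /existsP[j /andP[ji Gji]]; exists (lshift n j).
  by rewrite mulrC; apply: inI.
- by apply: leq_ltn_trans dm; rewrite leq_mul2r cF orbT.
Qed.

(** The saturation of J by X, in which every x_i can be cancelled. *)
Definition saturation (h : S) := exists k, X ^+ k * h \in J.

Lemma saturation_like : ideal_like saturation.
Proof.
split=> [|u v [k uk] [l vl]|a u [k uk]].
- by exists 0%N; rewrite mulr0 rpred0.
- exists (k + l)%N; rewrite mulrDr {1}addnC !exprD -!mulrA rpredD //; exact: idealMr.
- by exists k; rewrite mulrCA; apply: idealMr.
Qed.

Lemma saturation_x i h : saturation (x i * h) -> saturation h.
Proof.
move=> [k xk]; exists k.+1; rewrite exprS {1}(xvar_dvd_prod K i).
have -> : x i * \prod_(j < n | j != i) x j * X ^+ k * h =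
  \prod_(j < n | j != i) x j * (X ^+ k * (x i * h)) by ring.
exact: idealMr.
Qed.

(** Climb along [next]: by [edge_binomial3], x_(next i) f_iT is a combination of f_(next i,T) and
    the binomial of the edge from i to next i. *)
Lemma saturation_top i : exists2 T, T \notin U & saturation (f i T).
Proof.
have [s0 sD sM] := saturation_like.
move: {2}(n - i)%N (leqnn (n - i)) => k; elim: k i => [|k IH] i.
  by rewrite leqn0 subn_eq0 leqNgt ltn_ord.
case: (boolP (i \in U)) => [/nextP[ii Gi _] le|iU _]; last first.
  by exists i => //; rewrite edge_binomialii.
have [|T TU sT] := IH (next G i); first by move: le ii (ltn_ord (next G i)); clear; lia.
exists T => //; apply: (@saturation_x (next G i)); rewrite edge_binomial3.
apply: sD; apply: sM => //.
by exists 0%N; rewrite expr0 mul1r; apply: edge_binomial_ideal.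
Qed.

(** The row is a parameter so that one argument serves the x's and the y's. *)
Definition row_var (b : bool) : 'I_n -> 'I_(n + n) :=
  if b then @rshift n n else @lshift n n.

Lemma row_var_inj b : injective (row_var b).
Proof. by case: b; [exact: rshift_inj|exact: lshift_inj]. Qed.

(** Write u for row b and v for the other row. Up to sign f_iT is u_i v_T - u_T v_i, so each row-b
    variable over A in z^m allows one v_T to be exchanged for u_T. *)
Lemma saturation_shift b (T : 'I_n) (A : {set 'I_n}) :
    (forall i, i \in A -> saturation (f i T)) ->
  forall k (m : 'X_{1..n + n}), (k <= \sum_(i in A) m (row_var b i))%N ->
  exists r, saturation ('X_(row_var (~~ b) T) ^+ k * 'X_[m] - 'X_(row_var b T) ^+ k * r).
Proof.
have [s0 sD sM] := saturation_like.
move=> AT; elim=> [|k IH] m km.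
  by exists 'X_[m]; rewrite !expr0 subrr.
have [i iA mi] : exists2 i, i \in A & m (row_var b i) != 0%N.
  apply/not_exists2P => H; move: km; rewrite big1 // => i iA.
  by apply/eqP/negPn/negP; case: (H i).
have mE : (U_(row_var b i) + (m - U_(row_var b i)))%MM = m.
  by rewrite addmC submK // lep1mP.
have [|r Hr] := IH (m - U_(row_var b i))%MM.
  have Em : (\sum_(j in A) m (row_var b j) =
      (\sum_(j in A) (m - U_(row_var b i))%MM (row_var b j)).+1)%N.
    rewrite -{1}mE; under eq_bigr do rewrite mnmDE mnm1E (inj_eq (@row_var_inj b)).
    rewrite big_split /= -[RHS]add1n; congr (_ + _)%N.
    by rewrite (bigD1 i) //= eqxx big1 // => j /andP[_ /negPf]; rewrite eq_sym => ->.
  by move: km; rewrite Em.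
exists ('X_(row_var (~~ b) i) * r).
have sf : saturation ('X_(row_var b i) * 'X_(row_var (~~ b) T) -
                      'X_(row_var b T) * 'X_(row_var (~~ b) i)).
  have := AT i iA; case: (b) => /=; rewrite /edge_binomial /xvar /yvar //.
  by move/(sM (-1)); rewrite mulN1r opprB mulrC [X in _ - X]mulrC.
rewrite -{1}mE mpolyXD !exprS.
move: Hr sf; set u := 'X_(row_var b i); set vT := 'X_(row_var (~~ b) T).
set uT := 'X_(row_var b T); set v := 'X_(row_var (~~ b) i).
move=> Hr sf.
have -> : vT * vT ^+ k * (u * 'X_[m - U_(row_var b i)]) - uT * uT ^+ k * (v * r) =
  vT ^+ k * 'X_[m - U_(row_var b i)] * (u * vT - uT * v) +
  uT * v * (vT ^+ k * 'X_[m - U_(row_var b i)] - uT ^+ k * r) by ring.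
by apply: sD; apply: sM.
Qed.

(** All variables of one row become equal. Row b goes to the outer polynomial variable, so that
    evaluation at 0 kills it. *)
Definition line_var (b : bool) (k : 'I_(n + n)) : {poly {poly K}} :=
  match split k with inl _ => if b then 'X%:P else 'X
                   | inr _ => if b then 'X else 'X%:P end.

Definition line (b : bool) : S -> {poly {poly K}} :=
  mmap (polyC \o @polyC K) (line_var b).
HB.instance Definition _ b := GRing.RMorphism.on (line b).

Lemma lineX b k : line b 'X_k = line_var b k.
Proof. by rewrite /line mmapX mmap1U. Qed.

Lemma line_row b i : line b 'X_(row_var b i) = 'X.
Proof. by rewrite lineX /line_var; case: b; rewrite (unsplitK (inr i), unsplitK (inl i)). Qed.

Lemma line_rowN b i : line b 'X_(row_var (~~ b) i) = 'X%:P.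
Proof. by rewrite lineX /line_var; case: b; rewrite (unsplitK (inl i), unsplitK (inr i)). Qed.

Lemma line_edge b h : h \in J -> line b h = 0.
Proof.
move=> /mem_generated_ideal; apply: (@ideal_gen_min _ _ (fun h => line b h = 0)).
  split=> [|u v|a u]; first exact: rmorph0.
    by rewrite rmorphD /= => -> ->; rewrite addr0.
  by rewrite rmorphM /= => ->; rewrite mulr0.
move=> _ [i [j [_ _ ->]]]; rewrite /edge_binomial /xvar /yvar rmorphB !rmorphM /= !lineX.
rewrite /line_var !(unsplitK (inl _)) !(unsplitK (inr _)).
by rewrite subrr.
Qed.

Lemma line_const b (w : S) : (line b w).[0].[0] = w@_0%MM.
Proof.
elim/mpolyind: w => [|c m w _ _ IH]; first by rewrite rmorph0 !horner0 mcoeff0.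
rewrite rmorphD /= !hornerD IH mcoeffD; congr (_ + _).
rewrite mcoeffZ mcoeffX -mul_mpolyC rmorphM /= {1}/line mmapC /= !hornerM !hornerC.
congr (_ * _); case: (eqVneq m 0%MM) => [->|m0].
  by rewrite mpolyX0 rmorph1 !hornerC.
have [k mk] : exists k, m k != 0%N.
  apply/not_existsP => H; case/eqP: m0; apply/mnmP => k; rewrite mnm0E.
  by apply/eqP/negPn/negP/H.
have <- : (U_(k) + (m - U_(k)))%MM = m by rewrite addmC submK // lep1mP.
rewrite mpolyXD rmorphM /= lineX !hornerM /line_var.
by case: (split k) => _; case: (b); rewrite ?hornerX ?hornerC ?hornerX mul0r.
Qed.

(** Under [line b] J vanishes and X becomes nonzero, so the images satisfy v w = u w' with u the
    outer and v the inner variable; setting u = 0 leaves v w = 0. *)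
Lemma saturation_const b T (w w' : S) :
    saturation ('X_(row_var (~~ b) T) * w - 'X_(row_var b T) * w') ->
  w@_0%MM = 0.
Proof.
move=> [k /(line_edge b)]; rewrite rmorphM rmorphXn rmorph_prod rmorphB !rmorphM /=.
rewrite line_row line_rowN => /eqP; rewrite mulf_eq0 => /orP[|].
  rewrite expf_eq0 => /andP[_]; rewrite prodf_seq_eq0 => /hasP[i _ /=].
  rewrite lineX /line_var (unsplitK (inl i)).
  by case: b; rewrite ?polyC_eq0 polyX_eq0.
rewrite subr_eq0 => /eqP/(congr1 (fun P : {poly {poly K}} => P.[0])).
rewrite !hornerM hornerC hornerX mul0r => /eqP; rewrite mulf_eq0 polyX_eq0 /= => /eqP w0.
by rewrite -(line_const b) w0 horner0.
Qed.

(** The variables are grouped by row and by the vertex [top i]. As U and V have equal size there are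
    at most t groups, so degree above t (q - 1) forces degree at least q in one of them. *)
Lemma edge_ideal_degree_bound e :
  cartier_degree_bound p J e (edge_fpt G * (p ^ e - 1)).
Proof.
move=> rho [rhoD rhoZ rho0] m a dm.
have /choice[top topP] : forall i, exists T, T \notin U /\ saturation (f i T).
  by move=> i; have [T] := saturation_top i; exists T.
pose C T : {set 'I_n} := [set j | top j == T]%SET.
pose d b T := (\sum_(i in C T) m (row_var b i))%N.
have [b [T dT]] : exists b T, (p ^ e <= d b T)%N.
  apply/not_existsP => H; move: dm; apply/negP; rewrite -leqNgt.
  have small b T : (d b T <= p ^ e - 1)%N.
    rewrite -ltnS subn1 prednK // ltnNge; apply/negP => le; apply: (H b).
    by exists T.
  have sumd b : (\sum_i m (row_var b i) <= #|~: U| * (p ^ e - 1))%N.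
    rewrite (partition_big top (mem (~: U))) /=; last first.
      by move=> i _; rewrite finset.in_setC; case: (topP i).
    rewrite -sum_nat_const; apply: leq_sum => T _.
    by apply: leq_trans (small b T); rewrite /d; under [X in (_ <= X)%N]eq_bigl do rewrite inE.
  rewrite mdegE big_split_ord /= /edge_fpt.
  have -> : #|~: V| = #|~: U|.
    by rewrite cardsCs [RHS]cardsCs !finset.setCK (card_has_lower G_closed).
  by rewrite mulnDl; apply: leq_add; [exact: (sumd false)|exact: (sumd true)].
have [|r [k rk]] := saturation_shift (b := b) (T := T) (A := C T) _ dT.
  by move=> i; rewrite inE => /eqP<-; case: (topP i).
exists (repr (rho (a * 'X_[m]))); last by rewrite reprK.
apply: (@saturation_const b T _ (repr (rho (a * r)))); exists k.
have rhoN u : rho (- u) = - rho u.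
  by apply/eqP; rewrite -subr_eq0 opprK -rhoD addNr rho0 // rpred0.
(* Once multiplied by X^k, the factors v_T and u_T are moved into [rho] as q-th powers, where the
   relation [rk] applies. *)
rewrite mulrBr !mulrA; apply/pi_eq; rewrite !pi_mulr !reprK -!pi_mulr -!rhoZ.
apply: subr0_eq; rewrite -rhoN -rhoD; apply: rho0.
have qE : (p ^ e = (p ^ e - 1).+1)%N by rewrite subn1 prednK.
set vT := 'X_(row_var (~~ b) T) in rk *; set uT := 'X_(row_var b T) in rk *.
have -> : (X ^+ k * vT) ^+ (p ^ e) * (a * 'X_[m]) - (X ^+ k * uT) ^+ (p ^ e) * (a * r) =
  (X ^+ k) ^+ (p ^ e - 1) * a * (X ^+ k * (vT ^+ (p ^ e) * 'X_[m] - uT ^+ (p ^ e) * r)).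
  rewrite !exprMn {1 3}qE exprS; ring.
exact: idealMr.
Qed.

End UpperBound.

Theorem mainTheorem3 (RR : realType) (K : fieldType) (p : nat)
    (chK : p \in [pchar K]%R) (K_Ffinite : F_finite p K)
    (n : nat) (G : rel 'I_n) (G_simple : simple_graph G)
    (G_closed : closed_labelling G) :
  fpt RR chK (binomial_edge_ideal K G) =
  fpt RR chK (initial_ideal (binomial_edge_ideal K G)).
Proof.
have [G_sym _] := G_simple.
have lin0 a : a \in binomial_edge_ideal K G -> no_linear_terms a.
  exact: edge_ideal_no_linear_terms.
transitivity ((edge_fpt G)%:R : RR)%:E; [|apply/esym]; apply: fpt_eq.
- by move=> a /lin0/no_linear_terms_coeff; apply; rewrite mdeg0.
- by move=> e; apply: edge_ideal_degree_bound.
- move=> e; have [psi psiP] := frobenius_splitting_exists chK e K_Ffinite.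
  have [g [m [gI g1 dm]]] := edge_ideal_splitting G_sym chK G_closed psiP.
  by exists psi, g, m.
- move=> a /(initial_no_linear_terms lin0)/no_linear_terms_coeff; apply.
  by rewrite mdeg0.
- by move=> e; apply: initial_ideal_degree_bound.
- move=> e; have [psi psiP] := frobenius_splitting_exists chK e K_Ffinite.
  have [g [m [gI g1 dm]]] := initial_ideal_splitting G_sym chK G_closed psiP.
  by exists psi, g, m.
Qed.
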